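(* Let $\tau\in S_d$, let $R\in\mathbb N_+$ satisfy $\min_{1\le i\le d} n_i\ge R^2>\max_{1\le j\le d} r_j$ and $\min_{1\le j\le d} r_j\ge R$, and let $\vec{\mathbf u}\in\mathcal U^d_{\vec r,\vec n,\tau}$. Suppose there is a constant $\sigma>0$ such that for any $i_1,i_2,i_3,i_4\in\{1,\dots,d\}$ for which $(i_1,i_2,i_3,i_4)$ is of the correct order with respect to $\tau$ and any $y_i\in\{1,\dots,n_i\}$, $i\in\{1,\dots,d\}\setminus\{i_1,i_2,i_3,i_4\}$, the matrix $M_{(i_1,i_3),(i_2,i_4)}$ formed from $\varphi(\vec{\mathbf u},\tau)$ satisfies $\sigma_{R^4}(M_{(i_1,i_3),(i_2,i_4)})\ge\sigma$. Suppose that each observation of an entry of $\mathbf T=\varphi(\vec{\mathbf u},\tau)$ is contaminated by additive noise distributed as $\mathcal N(0,\sigma_e^2)$, $\sigma_e>0$, independently across observations. Let $n_{\max}=\max_{1\le i\le d} n_i$. Then for any $T<\frac{\sigma}{\sigma_e}$, any four distinct indices $i_1,i_2,i_3,i_4\in\{1,\dots,d\}$, and any $y_i\in\{1,\dots,n_i\}$, $i\in\{1,\dots,d\}\setminus\{i_1,i_2,i_3,i_4\}$, the probability that the Four-Index Algorithm, run with the integer $R$, these $y_i$ and the noisy observations, returns an incorrect ordering of $i_1,i_2,i_3,i_4$ (one not of the correct order with respect to $\tau$) is no more than $$6\exp\left(-\tfrac18\max\{T-4n_{\max},0\}^2\right).$$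
   Context: **Tensor ring format.** $d$ is a positive integer, $S_d$ is the group of permutations of $\{1,\dots,d\}$, and $\vec n=(n_1,\dots,n_d)$, $\vec r=(r_1,\dots,r_d)$ are vectors of positive integers. Arguments of $\tau$ and subscripts of $r$ are read modulo $d$ (so $\tau(d+1)=\tau(1)$, $r_{d+1}=r_1$). For $\tau\in S_d$ let $\mathcal U^d_{\vec r,\vec n,\tau}=\bigoplus_{i=1}^d\mathbb R^{r_{\tau^{-1}(i)}\times n_i\times r_{\tau^{-1}(i)+1}}$. For $\vec{\mathbf u}=(\mathbf u^{[1]},\dots,\mathbf u^{[d]})$ in it, write $\mathbf u^{[i]}(x)=\mathbf u^{[i]}(:,x,:)\in\mathbb R^{r_{\tau^{-1}(i)}\times r_{\tau^{-1}(i)+1}}$. The tensor $\varphi(\vec{\mathbf u},\tau)\in\mathbb R^{n_1\times\cdots\times n_d}$ has entries $$\varphi(\vec{\mathbf u},\tau)(x_1,\dots,x_d)=\mathrm{tr}\big(\mathbf u^{[\tau(1)]}(x_{\tau(1)})\,\mathbf u^{[\tau(2)]}(x_{\tau(2)})\cdots\mathbf u^{[\tau(d)]}(x_{\tau(d)})\big).$$ **Correct order.** For distinct $i_1,i_2,i_3,i_4\in\{1,\dots,d\}$, the tuple $(i_1,i_2,i_3,i_4)$ is of the correct order with respect to $\tau$ if there is $s\in\{1,2,3,4\}$ with $\tau^{-1}(i_s)<\tau^{-1}(i_{s+1})<\tau^{-1}(i_{s+2})<\tau^{-1}(i_{s+3})$ or $\tau^{-1}(i_s)>\tau^{-1}(i_{s+1})>\tau^{-1}(i_{s+2})>\tau^{-1}(i_{s+3})$,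 the subscripts of $i$ being read modulo 4. **Matricizations.** Given distinct $i_1,\dots,i_4$ and fixed $y_i\in\{1,\dots,n_i\}$ for $i\notin\{i_1,\dots,i_4\}$, let $A(x_{i_1},x_{i_2},x_{i_3},x_{i_4})$ be the entry of the tensor whose $i_s$-th coordinate is $x_{i_s}$ ($1\le s\le4$) and whose $i$-th coordinate is $y_i$ for all other $i$. Define $M_{(i_1,i_2),(i_3,i_4)}\in\mathbb R^{(n_{i_1}n_{i_2})\times(n_{i_3}n_{i_4})}$, $M_{(i_1,i_3),(i_2,i_4)}\in\mathbb R^{(n_{i_1}n_{i_3})\times(n_{i_2}n_{i_4})}$, $M_{(i_1,i_4),(i_2,i_3)}\in\mathbb R^{(n_{i_1}n_{i_4})\times(n_{i_2}n_{i_3})}$ by $M_{(i_1,i_2),(i_3,i_4)}((x_{i_1},x_{i_2}),(x_{i_3},x_{i_4}))=M_{(i_1,i_3),(i_2,i_4)}((x_{i_1},x_{i_3}),(x_{i_2},x_{i_4}))=M_{(i_1,i_4),(i_2,i_3)}((x_{i_1},x_{i_4}),(x_{i_2},x_{i_3}))=A(x_{i_1},x_{i_2},x_{i_3},x_{i_4})$. $\sigma_k(M)$ denotes the $k$-th largest singular value of $M$. **Four-Index Algorithm.** Input: $i_1,i_2,i_3,i_4$, an integer $R\in\mathbb N_+$, and an oracle for the entries of $\mathbf T$. Choose $y_i\in\{1,\dots,n_i\}$ for $i\notin\{i_1,\dots,i_4\}$; form the three matrices above from the (here noisy) observed entries of $\mathbf T$. Compare $a=\sigma_{R^4}(M_{(i_1,i_2),(i_3,i_4)})$,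 $b=\sigma_{R^4}(M_{(i_1,i_3),(i_2,i_4)})$, $c=\sigma_{R^4}(M_{(i_1,i_4),(i_2,i_3)})$. If $a>\max\{b,c\}$ return $(i_1,i_3,i_2,i_4)$; if $b>\max\{a,c\}$ return $(i_1,i_2,i_3,i_4)$; if $c>\max\{a,b\}$ return $(i_1,i_2,i_4,i_3)$. (If there is a tie and no case applies, this is counted as an incorrect output.) *)

(* Defs.v *)
From HB Require Import structures.
From mathcomp Require Import all_boot all_order all_algebra all_fingroup.
From mathcomp Require Import polyrcf.
From mathcomp Require Import all_classical all_reals all_analysis.

Set Implicit Arguments.
Unset Strict Implicit.
Unset Printing Implicit Defensive.

Import Order.TTheory GRing.Theory Num.Theory.
Local Open Scope ring_scope.

(* The square roots of the eigenvalues of M^T M, repeated according to their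
   algebraic multiplicity, in decreasing order. *)
Definition singular_values (K : realType) (m n : nat) (M : 'M[K]_(m, n)) :
    seq K :=
  let p := char_poly (M^T *m M) in
  sort >=%R (flatten [seq nseq (mup x p) (Num.sqrt x) | x <- rootsR p]).

(* k is counted from 1; the value is 0 when k exceeds the number of columns. *)
Definition singular_value (K : realType) (m n : nat) (k : nat)
    (M : 'M[K]_(m, n)) : K :=
  nth 0 (singular_values M) k.-1.

(* Positions and sites, numbered 1, ..., d on paper, are the elements
   0, ..., d - 1 of 'I_d; [ordS] is the successor modulo d. *)

Definition multi_index (d : nat) (n : 'I_d -> nat) :=
  {dffun forall i : 'I_d, 'I_(n i)}.

Definition tr_cores (K : realType) (d : nat) (n r : 'I_d -> nat)
    (tau : 'S_d) : Type :=
  forall i : 'I_d,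
    'I_(n i) -> 'M[K]_(r ((tau^-1)%g i), r (ordS ((tau^-1)%g i))).

Definition cyc (d : nat) (d_gt0 : (0 < d)%N) (k : nat) : 'I_d :=
  Ordinal (ltn_pmod k d_gt0).

Lemma ordS_cyc (d : nat) (d_gt0 : (0 < d)%N) (k : nat) :
  ordS (cyc d_gt0 k) = cyc d_gt0 k.+1.
Proof. by apply: val_inj; rewrite /= -addn1 modnDml addn1. Qed.

Lemma cyc_period (d : nat) (d_gt0 : (0 < d)%N) : cyc d_gt0 d = cyc d_gt0 0.
Proof. by apply: val_inj; rewrite /= modnn mod0n. Qed.

(* G 0 *m G 1 *m ... *m G (m - 1) *)
Fixpoint chain_mulmx (K : realType) (q : nat -> nat)
    (G : forall k : nat, 'M[K]_(q k, q k.+1)) (m : nat) : 'M[K]_(q 0, q m) :=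
  if m is m'.+1 then chain_mulmx G m' *m G m' else 1%:M.

Section TensorRing.
Variables (K : realType) (d : nat) (d_gt0 : (0 < d)%N).
Variables (n r : 'I_d -> nat) (tau : 'S_d).

Lemma core_row_dim (k : nat) :
  r ((tau^-1)%g (tau (cyc d_gt0 k))) = r (cyc d_gt0 k).
Proof. by rewrite permK. Qed.

Lemma core_col_dim (k : nat) :
  r (ordS ((tau^-1)%g (tau (cyc d_gt0 k)))) = r (cyc d_gt0 k.+1).
Proof. by rewrite permK ordS_cyc. Qed.

(* The (k + 1)-st factor u^[tau(k+1)](x_{tau(k+1)}) of the trace formula,
   transported along tau^-1 (tau j) = j. *)
Definition core_at (u : tr_cores K n r tau) (x : multi_index n) (k : nat) :
    'M[K]_(r (cyc d_gt0 k), r (cyc d_gt0 k.+1)) :=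
  castmx (core_row_dim k, core_col_dim k)
    (u (tau (cyc d_gt0 k)) (x (tau (cyc d_gt0 k)))).

Definition tr_tensor (u : tr_cores K n r tau) (x : multi_index n) : K :=
  \tr (castmx (erefl, congr1 r (cyc_period d_gt0))
        (chain_mulmx (q := fun k => r (cyc d_gt0 k)) (core_at u x) d)).

End TensorRing.

Definition correct_order (d : nat) (tau : 'S_d) (i : 4.-tuple 'I_d) : bool :=
  let pos (s : 'I_4) : nat := (tau^-1)%g (tnth i s) in
  uniq i &&
  [exists s : 'I_4,
     let s1 := ordS s in let s2 := ordS s1 in let s3 := ordS s2 in
     [&& pos s < pos s1, pos s1 < pos s2 & pos s2 < pos s3]%N ||
     [&& pos s > pos s1, pos s1 > pos s2 & pos s2 > pos s3]%N].

(* The inverse of [mxvec_index], see [pair_of_indexK]. *)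
Definition pair_of_index (m n : nat) (p : 'I_(m * n)) : 'I_m * 'I_n :=
  enum_val (cast_ord (esym (mxvec_cast m n)) p).

Lemma pair_of_indexK (m n : nat) (p : 'I_(m * n)) :
  mxvec_index (pair_of_index p).1 (pair_of_index p).2 = p.
Proof.
by rewrite /mxvec_index -surjective_pairing enum_valK cast_ordKV.
Qed.

(* y with its coordinates a, b, c, e overwritten. *)
Definition fill (d : nat) (n : 'I_d -> nat) (y : multi_index n)
    (a b c e : 'I_d) (xa : 'I_(n a)) (xb : 'I_(n b)) (xc : 'I_(n c))
    (xe : 'I_(n e)) : multi_index n :=
  [ffun i => dfwith (dfwith (dfwith (dfwith y a xa) b xb) c xc) e xe i].

(* M_{(a,b),(c,e)}: only the coordinates of y outside {a, b, c, e} matter. *)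
Definition matricization (K : realType) (d : nat) (n : 'I_d -> nat)
    (T : multi_index n -> K) (y : multi_index n) (a b c e : 'I_d) :
    'M[K]_(n a * n b, n c * n e) :=
  \matrix_(p, q)
    let: (xa, xb) := pair_of_index p in
    let: (xc, xe) := pair_of_index q in
    T (fill y xa xb xc xe).

(* [None] stands for a tie. *)
Definition four_index (K : realType) (d : nat) (n : 'I_d -> nat) (R : nat)
    (T : multi_index n -> K) (y : multi_index n) (i1 i2 i3 i4 : 'I_d) :
    option (4.-tuple 'I_d) :=
  let a := singular_value (R ^ 4) (matricization T y i1 i2 i3 i4) in
  let b := singular_value (R ^ 4) (matricization T y i1 i3 i2 i4) in
  let c := singular_value (R ^ 4) (matricization T y i1 i4 i2 i3) in
  if a > Num.max b c then Some [tuple i1; i3; i2; i4]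
  else if b > Num.max a c then Some [tuple i1; i2; i3; i4]
  else if c > Num.max a b then Some [tuple i1; i2; i4; i3]
  else None.

Definition incorrect_output (d : nat) (tau : 'S_d)
    (out : option (4.-tuple 'I_d)) : bool :=
  if out is Some i then ~~ correct_order tau i else true.

Definition mutually_independent (disp : measure_display)
    (Omega : measurableType disp) (K : realType) (P : probability Omega K)
    (I : finType) (X : I -> {RV P >-> K}) : Prop :=
  forall (J : {set I}) (A : I -> set K), (forall i, measurable (A i)) ->
    P [set w | forall i, i \in J -> A i (X i w)]%classic =
    (\prod_(i in J) P (X i @^-1` A i)%classic)%E.

(* Main.v *)
Require Import Defs.
From HB Require Import structures.
From mathcomp Require Import all_boot all_order all_algebra all_fingroup.
From mathcomp Require Import complex polyrcf spectral.
From mathcomp Require Import all_classical all_reals all_analysis measurable_realfun.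
From mathcomp Require Import ring lra zify.

(** In the crossing pairing of the four indices the true matricization has
    [sigma_(R^4) >= sigma]; in the two other pairings the ring is cut at two bonds, so the
    rank is below [R^4].  By Courant-Fischer, on a suitable space [V] of dimension [R^4] the
    noise has to push the first singular value down, and on a space [U] of codimension
    [R^4 - 1] inside the kernel it has to push the others up.  An error therefore requires
    [|E V| + |E' U| >= sigma], with [V] and [U] deterministic.

    The norm of a Gaussian matrix [G] restricted to a fixed subspace is controlled without
    Gaussian concentration.  For Gaussian vectors [h], [g] independent of [G],
    [exp (h^T G g - |h|^2 |g|^2 / 2)] has expectation 1 over [G].  Averaging over [h] and
    [g] first gives a random variable of mean 1, which a variational (PAC-Bayes) bound makes
    large as soon as [|G v|] is large for a single unit vector [v]; Markov's inequality
    concludes.  Since the two restricted widths have squares adding up to about [n_max^2],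
    the loss with respect to the sharp constants fits in the budget [4 n_max]. *)

Set Implicit Arguments.
Unset Strict Implicit.
Unset Printing Implicit Defensive.

Import Order.TTheory GRing.Theory Num.Theory.
Local Open Scope ring_scope.

(** * Euclidean norm and the real spectral theorem *)

Section Spectral.
Variable K : rcfType.

Definition dotv n (x y : 'cV[K]_n) : K := \sum_i x i 0 * y i 0.

Lemma dotvE n (x y : 'cV[K]_n) : dotv x y = (x^T *m y) 0 0.
Proof. by rewrite mxE; apply: eq_bigr => i _; rewrite mxE. Qed.

Lemma dotv_mulmxl m n (A : 'M[K]_(m, n)) x y : dotv (A *m x) y = dotv x (A^T *m y).
Proof. by rewrite !dotvE trmx_mul mulmxA. Qed.

Lemma dotvC n (x y : 'cV[K]_n) : dotv x y = dotv y x.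
Proof. by apply: eq_bigr => i _; rewrite mulrC. Qed.

Lemma dotvZl n a (x y : 'cV[K]_n) : dotv (a *: x) y = a * dotv x y.
Proof. by rewrite mulr_sumr; apply: eq_bigr => i _; rewrite mxE mulrA. Qed.

Lemma dotvDl n (x y z : 'cV[K]_n) : dotv (x + y) z = dotv x z + dotv y z.
Proof. by rewrite -big_split; apply: eq_bigr => i _; rewrite mxE mulrDl. Qed.

Lemma dotvDr n (x y z : 'cV[K]_n) : dotv z (x + y) = dotv z x + dotv z y.
Proof. by rewrite dotvC dotvDl !(dotvC z). Qed.

Lemma dotvZr n a (x y : 'cV[K]_n) : dotv x (a *: y) = a * dotv x y.
Proof. by rewrite dotvC dotvZl dotvC. Qed.

Lemma dotvv_ge0 n (x : 'cV[K]_n) : 0 <= dotv x x.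
Proof. by apply: sumr_ge0 => i _; rewrite -expr2 sqr_ge0. Qed.

Lemma dotvv_eq0 n (x : 'cV[K]_n) : (dotv x x == 0) = (x == 0).
Proof.
apply/eqP/eqP => [/eqP|->]; last first.
  by rewrite /dotv big1// => i _; rewrite mxE mulr0.
rewrite psumr_eq0 => [/allP x0|i _]; last by rewrite -expr2 sqr_ge0.
apply/colP => i; rewrite mxE; have := x0 i (mem_index_enum _).
by rewrite /= -expr2 sqrf_eq0 => /eqP.
Qed.

Lemma dotvv_gt0 n (x : 'cV[K]_n) : x != 0 -> 0 < dotv x x.
Proof. by rewrite -dotvv_eq0 lt_def dotvv_ge0 andbT. Qed.

Definition enorm n (x : 'cV[K]_n) : K := Num.sqrt (dotv x x).

Lemma enorm_ge0 n (x : 'cV[K]_n) : 0 <= enorm x.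
Proof. exact: sqrtr_ge0. Qed.

Lemma sqr_enorm n (x : 'cV[K]_n) : enorm x ^+ 2 = dotv x x.
Proof. by rewrite sqr_sqrtr// dotvv_ge0. Qed.

Lemma enorm_gt0 n (x : 'cV[K]_n) : x != 0 -> 0 < enorm x.
Proof. by move=> x0; rewrite sqrtr_gt0 dotvv_gt0. Qed.

Lemma enormZ n a (x : 'cV[K]_n) : enorm (a *: x) = `|a| * enorm x.
Proof. by rewrite /enorm dotvZl dotvZr mulrA -expr2 sqrtrM ?sqr_ge0// sqrtr_sqr. Qed.

Lemma cauchy_schwarz n (x y : 'cV[K]_n) : dotv x y <= enorm x * enorm y.
Proof.
have [->|x0] := eqVneq x 0.
  rewrite [dotv _ _](_ : _ = 0) ?mulr_ge0 ?enorm_ge0//.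
  by rewrite /dotv big1// => i _; rewrite mxE mul0r.
have [->|y0] := eqVneq y 0.
  rewrite [dotv _ _](_ : _ = 0) ?mulr_ge0 ?enorm_ge0//.
  by rewrite /dotv big1// => i _; rewrite mxE mulr0.
have := dotvv_ge0 (enorm y *: x + (- enorm x) *: y).
rewrite dotvDl !dotvDr !dotvZl !dotvZr (dotvC y) -!sqr_enorm.
have := enorm_gt0 x0; have := enorm_gt0 y0.
set a := enorm x; set b := enorm y; set c := dotv x y => b0 a0 h.
have : 0 <= 2 * (a * b) * (a * b - c) by nra.
by rewrite pmulr_rge0 ?subr_ge0// mulr_gt0// mulr_gt0.
Qed.

Lemma enormD n (x y : 'cV[K]_n) : enorm (x + y) <= enorm x + enorm y.
Proof.
rewrite -[leRHS]ger0_norm ?addr_ge0 ?enorm_ge0// -sqrtr_sqr ler_wsqrtr//.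
rewrite dotvDl !dotvDr (dotvC y) sqrrD -!sqr_enorm.
by have := cauchy_schwarz x y; lra.
Qed.

Lemma isometry_dotv m n (V : 'M[K]_(m, n)) x : V^T *m V = 1%:M ->
  dotv (V *m x) (V *m x) = dotv x x.
Proof. by move=> VV; rewrite dotv_mulmxl mulmxA VV mul1mx. Qed.

Lemma isometry_enorm m n (V : 'M[K]_(m, n)) x : V^T *m V = 1%:M ->
  enorm (V *m x) = enorm x.
Proof. by move=> VV; rewrite /enorm isometry_dotv. Qed.

(** The Hermitian spectral theorem over the complexification of [K] gives a real eigenvalue. Being
    an eigenvalue depends only on the characteristic polynomial, so it descends to [K] and provides
    an eigenvector there. *)
Lemma sym_eigenvector n (A : 'M[K]_n.+1) : A^T = A ->
  exists v a, dotv v v = 1 /\ A *m v = a *: v.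
Proof.
move=> As; pose toC := real_complex K.
have AC : map_mx toC A \is hermsymmx.
  apply: realsym_hermsym.
    by apply/is_hermitianmxP; rewrite expr0 scale1r map_mx_id// map_trmx As.
  by apply/mxOverP => i j; rewrite mxE; apply/complex_realP; exists (A i j).
have /hermitian_spectral_diag_real/mxOverP/(_ 0 0) := AC.
set d := spectral_diag _ => /complex_realP[a da].
have /hermitian_normalmx/orthomx_spectralP := AC.
set P := spectralmx _ => AP.
have Pu : P \in unitmx by exact: spectral_unit.
have : eigenvalue (map_mx toC A) (toC a).
  apply/eigenvalueP; exists (row 0 P).
    rewrite -row_mul AP -/d !mulmxA mulmxV// mul1mx row_mul row_diag_mx -/P.
    by rewrite -scalemxAl -rowE da.
  by apply/eqP => P0; have := row_free_unit P; rewrite Pu => /row_freeP[B /(congr1 (row 0))];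
    rewrite row_mul P0 mul0mx => /rowP/(_ 0)/eqP; rewrite !mxE eqxx eq_sym oner_eq0.
rewrite eigenvalue_map => /eigenvalueP[w wA w0].
have wT0 : w^T != 0 by rewrite trmx_eq0.
exists ((enorm w^T)^-1 *: w^T), a; split.
  rewrite dotvZl dotvZr -sqr_enorm; have := enorm_gt0 wT0.
  by move=> /lt0r_neq0 e0; field.
by rewrite -scalemxAr -{1}As -trmx_mul wA linearZ/= scalerA mulrC -scalerA.
Qed.

(** The reflection along [v - e], with [e] the first basis vector, exchanges the unit vectors [v]
    and [e]; when [v = e] the identity serves. *)
Lemma householder n (v : 'cV[K]_n.+1) : dotv v v = 1 ->
  exists H : 'M[K]_n.+1, [/\ H^T = H, H *m H = 1%:M & H *m delta_mx 0 0 = v].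
Proof.
move=> v1; pose e : 'cV[K]_n.+1 := delta_mx 0 0.
have [ve|ve] := eqVneq v e.
  by exists 1%:M; rewrite trmx1 !mul1mx.
pose w := v - e; have w0 : w != 0 by rewrite subr_eq0.
have ee : dotv e e = 1.
  rewrite /dotv (bigD1 0)//= big1 ?mxE ?eqxx ?mulr1 ?addr0// => i i0.
  by rewrite !mxE (negbTE i0) mul0r.
have ww : dotv w w = - 2 * dotv w e.
  rewrite /w -!scaleN1r !(dotvDl, dotvDr, dotvZl, dotvZr) ee v1 (dotvC e v).
  ring.
have wwM : w^T *m w = (dotv w w)%:M.
  by apply/matrixP => i j; rewrite !ord1 dotvE !mxE eqxx mulr1n.
have wn : dotv w w != 0 by rewrite dotvv_eq0.
exists (1%:M - (2 / dotv w w) *: (w *m w^T)); split.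
- by rewrite raddfB/= trmx1 linearZ/= trmx_mul trmxK.
- rewrite mulmxBl mul1mx mulmxBr mulmx1 -scalemxAl -scalemxAr.
  rewrite mulmxA -(mulmxA w) wwM mul_mx_scalar -scalemxAl !scalerA.
  set W := w *m w^T; rewrite -addrA -[RHS]addr0; congr (_ + _).
  rewrite -scalerBl -!scaleNr -scalerDl -[RHS](scale0r W); congr (_ *: _).
  by field.
- rewrite mulmxBl mul1mx -scalemxAl -mulmxA.
  have -> : w^T *m e = (dotv w e)%:M.
    by apply/matrixP => i j; rewrite !ord1 dotvE !mxE eqxx mulr1n.
  rewrite mul_mx_scalar scalerA -/e ww.
  have we0 : dotv w e != 0 by apply: contra_neq wn => we0; rewrite ww we0 mulr0.
  have -> : 2 / (- 2 * dotv w e) * dotv w e = - 1 by field.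
  by rewrite scaleN1r opprK addrC subrK.
Qed.

(** Deflation: conjugation by the reflection that sends the first basis vector to a unit eigenvector
    clears the first column, symmetry clears the first row, and induction diagonalizes the remaining
    block. *)
Lemma sym_spectral n (A : 'M[K]_n) : A^T = A ->
  exists (Q : 'M[K]_n) (d : 'rV[K]_n), Q^T *m Q = 1%:M /\ A *m Q = Q *m diag_mx d.
Proof.
elim: n A => [|n IH] A As.
  by exists 1%:M, 0; split; apply/matrixP => -[].
have [v [a [v1 Av]]] := sym_eigenvector As.
have [H [HT HH He]] := householder v1.
pose B : 'M[K]_(1 + n) := H *m A *m H.
have BT : B^T = B by rewrite !trmx_mul HT As mulmxA.
have Be : B *m delta_mx 0 0 = a *: (delta_mx 0 0 : 'cV_(1 + n)).
  by rewrite -mulmxA He -mulmxA Av -scalemxAr -He mulmxA HH mul1mx.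
have AH : A *m H = H *m B by rewrite /B !mulmxA HH mul1mx.
clearbody B.
have B0 i : B i (lshift n 0) = a * (i == lshift n 0)%:R.
  have l0 : lshift n (0 : 'I_1) = 0 by exact: val_inj.
  have /colP/(_ i) := Be; rewrite -l0 -colE !mxE => ->.
  by rewrite eqxx andbT.
have [Q' [d' [QQ' AQ']]] := IH (drsubmx B) (etrans (trmx_drsub B) (congr1 _ BT)).
have EB : B = block_mx a%:M 0 0 (drsubmx B).
  rewrite -[LHS]submxK; congr block_mx; apply/matrixP => i j; rewrite !mxE.
  - by rewrite !ord1 B0 eqxx mulr1 mulr1n.
  - by rewrite ord1 -BT mxE B0 eq_rlshift mulr0.
  - by rewrite ord1 B0 eq_rlshift mulr0.
pose Q1 : 'M[K]_(1 + n) := block_mx 1%:M 0 0 Q'.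
have QQ1 : Q1^T *m Q1 = 1%:M.
  rewrite tr_block_mx mulmx_block !trmx0 !mulmx0 !mul0mx !addr0 !add0r QQ'.
  by rewrite trmx1 mulmx1 -scalar_mx_block.
exists (H *m Q1), (row_mx a%:M d'); split.
  by rewrite trmx_mul HT mulmxA -(mulmxA Q1^T) HH mulmx1.
have BQ : B *m Q1 = Q1 *m diag_mx (row_mx a%:M d').
  rewrite {1}EB diag_mx_row !mulmx_block !mulmx0 !mul0mx !addr0 !add0r AQ'.
  rewrite mulmx1 mul1mx; congr block_mx.
  by apply/matrixP => i j; rewrite !ord1 !mxE.
by rewrite mulmxA AH -!mulmxA BQ.
Qed.

End Spectral.

(** * Singular values *)

Section SingularValues.
Variable K : realType.

Lemma char_poly_orthogonal_diag n (A Q : 'M[K]_n) (d : 'rV[K]_n) :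
  Q^T *m Q = 1%:M -> A *m Q = Q *m diag_mx d ->
  char_poly A = \prod_i ('X - (d 0 i)%:P).
Proof.
move=> QQ AQ; have QQ' := mulmx1C QQ.
have -> : \prod_i ('X - (d 0 i)%:P) = char_poly (diag_mx d).
  rewrite char_poly_trig; last exact/is_diag_mx_is_trig/diag_mx_is_diag.
  by apply: eq_bigr => i _; rewrite mxE eqxx mulr1n.
have AE : A = Q *m diag_mx d *m Q^T by rewrite -AQ -mulmxA QQ' mulmx1.
rewrite /char_poly {1}AE /char_poly_mx !map_mxM/=.
set Qp := map_mx _ Q; set Qt := map_mx _ Q^T.
have QQp : Qp *m Qt = 1%:M by rewrite -map_mxM QQ' map_mx1.
rewrite (_ : _ - _ = Qp *m ('X%:M - map_mx polyC (diag_mx d)) *m Qt).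
  by rewrite !det_mulmx mulrC mulrA -det_mulmx (mulmx1C QQp) det1 mul1r.
by rewrite mulmxBr mulmxBl scalar_mxC -(mulmxA _ Qp) QQp mulmx1.
Qed.

(** Recovers the list of eigenvalues [s] from the list [r] of distinct roots and their
    multiplicities. *)
Lemma flatten_nseq_perm (T : eqType) (s r : seq T) : uniq r ->
  (forall x, x \in s -> x \in r) ->
  perm_eq (flatten [seq nseq (count_mem x s) x | x <- r]) s.
Proof.
move=> ur sr; apply/allP => x _ /=; apply/eqP.
rewrite count_flatten -map_comp sumnE big_map.
have [xr|xr] := boolP (x \in r).
  rewrite (bigD1_seq x)//= count_nseq/= eqxx mul1n big1 ?addn0// => y yx.
  by rewrite count_nseq/= (negbTE yx) mul0n.
rewrite big_seq big1 => [|y yr]; last first.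
  rewrite /= count_nseq/=; have [yx|_] := eqVneq y x; last by rewrite mul0n.
  by rewrite -yx yr in xr.
by apply/esym/count_memPn/negP => /sr; apply/negP.
Qed.

(** The characteristic polynomial is the product of the ['X - d 0 i], so the multiplicity [mup] of a
    root is the number of its occurrences in [d]. *)
Lemma singular_values_diag m n (A : 'M[K]_(m, n)) (Q : 'M[K]_n) (d : 'rV[K]_n) :
  Q^T *m Q = 1%:M -> A^T *m A *m Q = Q *m diag_mx d ->
  singular_values A = sort >=%R [seq Num.sqrt (d 0 i) | i <- enum 'I_n].
Proof.
move=> QQ AQ; rewrite /singular_values (char_poly_orthogonal_diag QQ AQ).
set ds := [seq d 0 i | i <- enum 'I_n].
have -> : \prod_i ('X - (d 0 i)%:P) = \prod_(x <- ds) ('X - x%:P).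
  by rewrite big_map big_enum.
set p := \prod_(x <- ds) _.
have p0 : p != 0 by rewrite monic_neq0 ?monic_prod_XsubC.
apply/perm_sortP; [exact: ge_total|exact: ge_trans|exact: ge_anti|].
have -> : [seq nseq (mup x p) (Num.sqrt x) | x <- rootsR p] =
    [seq map Num.sqrt t | t <- [seq nseq (count_mem x ds) x | x <- rootsR p]].
  rewrite -map_comp; apply: eq_map => x /=.
  by rewrite map_nseq mu_prod_XsubC.
rewrite -map_flatten [X in perm_eq _ X](_ : _ = map Num.sqrt ds); last first.
  by rewrite /ds -[RHS]map_comp.
apply/perm_map/flatten_nseq_perm; first exact: uniq_roots.
move=> x xds; have := roots_on_rootsR p0 x.
by rewrite in_itv/= => <-; rewrite root_prod_XsubC.
Qed.

Lemma singular_value_decomposition m n (A : 'M[K]_(m, n)) :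
  exists (Q : 'M[K]_n) (f : 'I_n -> K),
  [/\ Q^T *m Q = 1%:M,
      A^T *m A *m Q = Q *m diag_mx (\row_i f i ^+ 2),
      (forall i, 0 <= f i),
      (forall i j : 'I_n, (i <= j)%N -> f j <= f i) &
      (forall k : 'I_n, singular_value k.+1 A = f k)].
Proof.
have [|Q [d [QQ AQ]]] := @sym_spectral K n (A^T *m A).
  by rewrite trmx_mul trmxK.
have d0 i : 0 <= d 0 i.
  have : (Q^T *m (A^T *m A *m Q)) i i = d 0 i.
    by rewrite AQ mulmxA QQ mul1mx mxE eqxx mulr1n.
  rewrite !mulmxA -trmx_mul -mulmxA => <-; rewrite mxE.
  by apply: sumr_ge0 => j _; rewrite mxE -expr2 sqr_ge0.
pose g i := Num.sqrt (d 0 i).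
(* Indices are sorted instead of values, so that the columns of [Q] can be permuted along with their
   eigenvalues. *)
pose ks := sort (fun i j => g j <= g i) (enum 'I_n).
have sis : size ks = n by rewrite size_sort -cardE card_ord.
pose it := @Tuple n _ ks (introT eqP sis).
have it_inj : injective (tnth it).
  apply/injectiveP; rewrite /injectiveb /dinjectiveb.
  rewrite (_ : [seq _ | _ <- _] = ks).
    by rewrite sort_uniq enum_uniq.
  by rewrite -[RHS](map_tnth_enum it).
exists (colsub (tnth it) Q), (g \o tnth it); split.
- apply/matrixP => i j; have /matrixP/(_ (tnth it i) (tnth it j)) := QQ.
  rewrite !mxE (inj_eq it_inj) => <-.
  by apply: eq_bigr => k _; rewrite !mxE.
- apply/matrixP => i j; have /matrixP/(_ i (tnth it j)) := AQ.
  rewrite !mul_mx_diag !mxE /g sqr_sqrtr//= => <-.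
  by apply: eq_bigr => k _; rewrite !mxE.
- by move=> i /=; exact: sqrtr_ge0.
- move=> i j ij /=; have : sorted (fun i j => g j <= g i) ks.
    by apply: sort_sorted => x y; exact: le_total.
  move=> ksr; have tr : transitive (fun i j => g j <= g i).
    by move=> y x z /= xy yz; exact: le_trans yz xy.
  rewrite !(tnth_nth i) /=.
  by apply: (sorted_leq_nth tr _ i ksr) => //; rewrite inE sis.
- move=> k; rewrite /singular_value (singular_values_diag QQ AQ)/=.
  rewrite (_ : sort _ _ = map g ks); last by rewrite /ks sort_map.
  by rewrite (nth_map k) ?sis//= (tnth_nth k).
Qed.

End SingularValues.

(** * Courant-Fischer subspaces and perturbation of singular values *)

Section CourantFischer.
Variable K : realType.

Lemma singular_value_ge0 m n k (A : 'M[K]_(m, n)) : (0 < k <= n)%N ->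
  0 <= singular_value k A.
Proof.
case: k => // k /= kn; have [Q [f [_ _ f0 _ fk]]] := singular_value_decomposition A.
by rewrite (fk (Ordinal kn)).
Qed.

(** In an eigenbasis of [A^T *m A] the form [|A x|^2] is diagonal; restricting it to the columns
    chosen by [h] keeps exactly the corresponding coefficients. *)
Lemma colsub_eigenbasis m n p (A : 'M[K]_(m, n)) (Q : 'M[K]_n) (f : 'I_n -> K)
    (h : 'I_p -> 'I_n) : injective h -> Q^T *m Q = 1%:M ->
  A^T *m A *m Q = Q *m diag_mx (\row_i f i ^+ 2) ->
  (colsub h Q)^T *m colsub h Q = 1%:M /\
  forall x, dotv (A *m (colsub h Q *m x)) (A *m (colsub h Q *m x)) =
    \sum_i f (h i) ^+ 2 * x i 0 ^+ 2.
Proof.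
move=> h_inj QQ AQ.
have -> : colsub h Q = Q *m colsub h 1%:M.
  by rewrite mulmx_colsub mulmx1.
set P := colsub h 1%:M.
have PP (d : 'rV[K]_n) : P^T *m diag_mx d *m P = diag_mx (\row_i d 0 (h i)).
  apply/matrixP => i j; rewrite mul_mx_diag !mxE (bigD1 (h i))//= big1 => [|l li].
    rewrite !mxE eqxx (inj_eq h_inj) mul1r addr0.
    by have [->|] := eqVneq i j; rewrite ?mulr1 ?mulr0.
  by rewrite !mxE (negbTE li) !mul0r.
split.
  rewrite trmx_mul mulmxA -(mulmxA _ Q^T) QQ.
  have := PP (const_mx 1); rewrite diag_const_mx => ->.
  by rewrite -diag_const_mx; congr diag_mx; apply/rowP => i; rewrite !mxE.
have AP : (Q *m P)^T *m (A^T *m (A *m (Q *m P))) =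
    P^T *m diag_mx (\row_i f i ^+ 2) *m P.
  have -> : A^T *m (A *m (Q *m P)) = A^T *m A *m Q *m P by rewrite !mulmxA.
  rewrite AQ trmx_mul !mulmxA.
  by rewrite -[P^T *m Q^T *m Q]mulmxA QQ mulmx1.
move=> x; rewrite dotv_mulmxl dotv_mulmxl.
have -> : (Q *m P)^T *m (A^T *m (A *m (Q *m P *m x))) =
    (Q *m P)^T *m (A^T *m (A *m (Q *m P))) *m x by rewrite !mulmxA.
rewrite AP PP; apply: eq_bigr => i _.
by rewrite mul_diag_mx !mxE mulrCA -expr2.
Qed.

(** [V] spans the [k] leading right singular vectors. *)
Lemma singular_value_lower m n k (A : 'M[K]_(m, n)) : (0 < k <= n)%N ->
  exists V : 'M[K]_(n, k), V^T *m V = 1%:M /\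
    forall x, singular_value k A * enorm x <= enorm (A *m (V *m x)).
Proof.
case: k => // k /= kn; have [Q [f [QQ AQ f0 fle fk]]] := singular_value_decomposition A.
have h_inj : injective (widen_ord kn) by move=> i j /(congr1 val) /= /val_inj.
have [VV VE] := colsub_eigenbasis h_inj QQ AQ.
exists (colsub (widen_ord kn) Q); split=> // x.
rewrite (fk (Ordinal kn)) -[f _]ger0_norm// -enormZ ler_wsqrtr// VE.
rewrite dotvZl dotvZr mulrA -expr2 mulr_sumr; apply: ler_sum => i _.
rewrite -expr2 ler_wpM2r ?sqr_ge0// lerXn2r ?nnegrE//.
by apply: fle => /=; rewrite -ltnS.
Qed.

(** [U] spans the right singular vectors from the [k]-th on. Including the [k]-th gives dimension
    [n - k + 1], just enough to meet every space of dimension [k]. *)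
Lemma singular_value_upper m n k (A : 'M[K]_(m, n)) : (0 < k <= n)%N ->
  exists U : 'M[K]_(n, (n - k).+1), U^T *m U = 1%:M /\
    forall x, enorm (A *m (U *m x)) <= singular_value k A * enorm x.
Proof.
case: k => // k /= kn; have [Q [f [QQ AQ f0 fle fk]]] := singular_value_decomposition A.
have hlt (i : 'I_(n - k.+1).+1) : (k + i < n)%N by have := ltn_ord i; lia.
pose h i := Ordinal (hlt i).
have h_inj : injective h by move=> i j /(congr1 val) /= /addnI /val_inj.
have [VV VE] := colsub_eigenbasis h_inj QQ AQ.
exists (colsub h Q); split=> // x.
rewrite (fk (Ordinal kn)) -[f _]ger0_norm// -enormZ ler_wsqrtr// VE.
rewrite dotvZl dotvZr mulrA -expr2 mulr_sumr; apply: ler_sum => i _.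
rewrite -expr2 ler_wpM2r ?sqr_ge0// lerXn2r ?nnegrE//.
by apply: fle => /=; rewrite leq_addr.
Qed.

(** Counting dimensions, [row_mx B (- C)] has a nonzero kernel vector; its first component is
    nonzero because [C] is injective. *)
Lemma isometry_intersection n p q (B : 'M[K]_(n, p)) (C : 'M[K]_(n, q)) :
  C^T *m C = 1%:M -> (n < p + q)%N ->
  exists (x : 'cV[K]_p) (y : 'cV[K]_q), x != 0 /\ B *m x = C *m y.
Proof.
move=> CC npq; pose M := row_mx B (- C).
have : kermx M^T != 0.
  rewrite kermx_eq0 /row_free mxrank_tr; apply/negP => /eqP rM.
  by have := rank_leq_row M; rewrite rM leqNgt npq.
move=> /rowV0Pn[z /sub_kermxP zM z0].
have zE : z^T = col_mx (usubmx z^T) (dsubmx z^T) by rewrite vsubmxK.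
have : M *m z^T = 0 by rewrite -[M]trmxK -trmx_mul zM trmx0.
rewrite zE mul_row_col mulNmx => /eqP; rewrite subr_eq0 => /eqP xy.
exists (usubmx z^T), (dsubmx z^T); split => //.
apply: contra_neq z0 => x0; apply: trmx_inj; rewrite zE x0 trmx0.
have := congr1 (mulmx C^T) xy; rewrite mulmxA mulmxA CC mul1mx x0 mulmx0 => <-.
by rewrite col_mx0.
Qed.

(** [V] is chosen before [E], so it stays deterministic when [E] is random. It meets the trailing
    singular space of [M + E], and the triangle inequality at a common vector gives the bound. *)
Lemma singular_value_perturb_big m n k (M : 'M[K]_(m, n)) : (0 < k <= n)%N ->
  exists V : 'M[K]_(n, k), V^T *m V = 1%:M /\ forall E, exists v, v != 0 /\
    (singular_value k M - singular_value k (M + E)) * enorm v <= enorm (E *m (V *m v)).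
Proof.
move=> kn; have [V [VV VM]] := singular_value_lower M kn.
exists V; split=> // E; have [U [UU UM]] := singular_value_upper (M + E) kn.
have [|x [y [x0 xy]]] := isometry_intersection V UU; first by lia.
exists x; split => //; rewrite mulrBl lerBlDr.
have exy : enorm y = enorm x by rewrite -(isometry_enorm y UU) -xy isometry_enorm.
apply: le_trans (VM x) _; rewrite -exy addrC; have := UM y; rewrite -xy => h.
have -> : M *m (V *m x) = (M + E) *m (V *m x) + (- 1) *: (E *m (V *m x)).
  by rewrite scaleN1r mulmxDl addrK.
apply: le_trans (enormD _ _) _; rewrite enormZ normrN1 mul1r.
by rewrite lerD2r.
Qed.

(** Here [U] lies in the kernel of [M] and is again chosen before [E]. On it [M + E] acts as [E],
    and it meets the leading singular space of [M + E]. *)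
Lemma singular_value_perturb_small m n k (M : 'M[K]_(m, n)) :
  (\rank M < k)%N -> (k <= n)%N ->
  exists U : 'M[K]_(n, (n - k).+1), U^T *m U = 1%:M /\ forall E, exists v, v != 0 /\
    singular_value k (M + E) * enorm v <= enorm (E *m (U *m v)).
Proof.
move=> rk kn; have kn' : (0 < k <= n)%N by rewrite kn andbT; case: k rk {kn}.
have [U [UU UM]] := singular_value_upper M kn'.
(* A positive value would make [M] injective on a space of dimension [k], against the rank bound. *)
have s0 : singular_value k M = 0.
  apply/eqP; rewrite eq_le singular_value_ge0// andbT leNgt; apply/negP => s_gt0.
  have [V [VV VM]] := singular_value_lower M kn'.
  suff : row_free (M *m V)^T.
    rewrite /row_free mxrank_tr => /eqP rMV.
    by have := mxrankM_maxl M V; rewrite rMV leqNgt rk.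
  rewrite -kermx_eq0; apply/rowV0P => z /sub_kermxP/(congr1 trmx).
  rewrite trmx_mul trmxK trmx0 -mulmxA => MVz.
  apply: contraTeq s_gt0 => z0; rewrite -leNgt.
  have := VM z^T; rewrite MVz [enorm 0](_ : _ = 0); last first.
    by rewrite /enorm (_ : dotv _ _ = 0) ?sqrtr0//; apply/eqP; rewrite dotvv_eq0.
  by rewrite pmulr_lle0// enorm_gt0// trmx_eq0.
have MU (x : 'cV[K]_(n - k).+1) : M *m (U *m x) = 0.
  suff : dotv (M *m (U *m x)) (M *m (U *m x)) == 0 by rewrite dotvv_eq0 => /eqP.
  rewrite -sqr_enorm sqrf_eq0 eq_le enorm_ge0 andbT.
  by have := UM x; rewrite s0 mul0r.
exists U; split=> // E; have [V [VV VM]] := singular_value_lower (M + E) kn'.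
have [|x [y [x0 xy]]] := isometry_intersection U VV; first by lia.
exists x; split => //.
have exy : enorm y = enorm x by rewrite -(isometry_enorm y VV) -xy isometry_enorm.
by have := VM y; rewrite -xy exy mulmxDl MU add0r.
Qed.

Definition frob2 m n (X : 'M[K]_(m, n)) : K := \sum_i \sum_j X i j ^+ 2.

Lemma enorm_mulmx_frob m n (X : 'M[K]_(m, n)) v :
  enorm (X *m v) <= Num.sqrt (frob2 X) * enorm v.
Proof.
have X0 : 0 <= frob2 X by apply: sumr_ge0 => i _; apply: sumr_ge0 => j _; exact: sqr_ge0.
rewrite -sqrtrM// ler_wsqrtr// mulr_suml; apply: ler_sum => i _.
have := cauchy_schwarz (row i X)^T v; have := cauchy_schwarz (- 1 *: (row i X)^T) v.
rewrite dotvZl enormZ normrN1 mul1r.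
have -> : dotv (row i X)^T v = (X *m v) i 0.
  by rewrite mxE; apply: eq_bigr => j _; rewrite !mxE.
rewrite -sqr_enorm (_ : \sum_j _ = enorm (row i X)^T ^+ 2); last first.
  by rewrite sqr_enorm; apply: eq_bigr => j _; rewrite !mxE -expr2.
rewrite -expr2 -exprMn mulN1r => h1 h2.
rewrite -[leLHS]real_normK ?num_real// lerXn2r ?nnegrE ?mulr_ge0 ?enorm_ge0//.
by rewrite ler_norml h2 lerNl h1.
Qed.

(** The continuity estimate behind measurability. *)
Lemma singular_value_lipschitz m n k (A C : 'M[K]_(m, n)) : (0 < k <= n)%N ->
  singular_value k A <= singular_value k C + Num.sqrt (frob2 (C - A)).
Proof.
move=> kn; have [V [VV VE]] := singular_value_perturb_big A kn.
have [v [v0]] := VE (C - A); rewrite (addrC A) subrK => h.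
have := le_trans h (enorm_mulmx_frob _ _).
by rewrite isometry_enorm// ler_pM2r ?enorm_gt0// lerBlDl.
Qed.

End CourantFischer.

(** * Measurability *)

Section MeasurableSingularValue.
Variables (K : realType) (disp : measure_display) (X : measurableType disp).

Lemma rat_matrix_approx m n (A : 'M[K]_(m, n)) (e : K) : 0 < e ->
  exists C : 'M[rat]_(m, n), frob2 (map_mx ratr C - A) < e ^+ 2.
Proof.
move=> e0; pose N : K := (m * n).+1%:R; have N0 : 0 < N by rewrite ltr0n.
have dex i j : exists q : rat, (ratr q - A i j) ^+ 2 < e ^+ 2 / N.
  have [a [aE a0]] : exists a, a = e / N /\ 0 < a by exists (e / N); rewrite divr_gt0.
  have [|q] := @rat_in_itvoo K (A i j - a) (A i j + a); first by lra.
  rewrite in_itv/= => /andP[q1 q2]; exists q.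
  apply: (@lt_le_trans _ _ (a ^+ 2)).
    rewrite -[ltLHS]real_normK ?num_real// ltrXn2r// ?ltr_norml ?nnegrE ?(ltW a0)//.
    by apply/andP; split; lra.
  rewrite aE expr_div_n ler_wpM2l ?sqr_ge0// expr2 invfM ler_piMl ?invr_ge0 ?(ltW N0)//.
  by rewrite invf_le1// ler1n.
exists (\matrix_(i, j) projT1 (cid (dex i j))).
apply: (@le_lt_trans _ _ (\sum_(i < m) \sum_(j < n) e ^+ 2 / N)).
  apply: ler_sum => i _; apply: ler_sum => j _; rewrite !mxE.
  by case: cid => q /= /ltW.
rewrite !sumr_const !card_ord -!mulrnA -mulr_natr -mulrA gtr_pMr ?exprn_gt0//.
by rewrite mulrC ltr_pdivrMr// mul1r ltr_nat mulnC.
Qed.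

(** By the Lipschitz bound, a superlevel set is a countable union, over rational centers and radii,
    of preimages of Frobenius balls on which the singular value is certainly above [q]. *)
Lemma measurable_singular_value m n k (A : X -> 'M[K]_(m, n)) : (0 < k <= n)%N ->
  (forall i j, measurable_fun setT (fun x => A x i j)) ->
  measurable_fun setT (fun x => singular_value k (A x)).
Proof.
move=> kn mA; apply: (measurability _ (RGenOInfty.measurableE K)).
move=> _ [_ [q ->] <-]; rewrite setTI.
pose F (Ce : 'M[rat]_(m, n) * rat) : set X :=
  [set x | (0 < Ce.2) && (q + ratr Ce.2 < singular_value k (map_mx ratr Ce.1)) &&
    (frob2 (map_mx ratr Ce.1 - A x) < ratr Ce.2 ^+ 2)]%classic.
rewrite [X in measurable X](_ : _ = (\bigcup_Ce F Ce)%classic).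
  apply: countable_bigcupT_measurable => [|[C e]].
    exact: countableP.
  rewrite /F/=; case: (_ && _) => /=; last by rewrite set_false.
  have mF : measurable_fun setT (fun x => frob2 (map_mx ratr C - A x)).
    apply: measurable_sum => i; apply: measurable_sum => j.
    apply: measurable_funX; rewrite (_ : (fun x => _) = fun x => ratr (C i j) - A x i j).
      by apply: measurable_funB.
    by apply/funext => x; rewrite !mxE.
  rewrite -[X in measurable X]setTI; apply: (measurable_fun_ltr mF) => //.
apply/seteqP; split => x /=.
  rewrite in_itv/= andbT => qx.
  (* Half of the gap, since the Lipschitz bound is spent twice: from [A x] to the center, and as the
     margin at the center. *)
  have [|e] := @rat_in_itvoo K 0 ((singular_value k (A x) - q) / 2).
    by rewrite divr_gt0// subr_gt0.
  rewrite in_itv/= => /andP[e0 eq]; have [C CA] := rat_matrix_approx (A x) e0.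
  exists (C, e) => //=; rewrite /F/= CA andbT; rewrite -(ltr0q K) e0/=.
  have := singular_value_lipschitz (A x) (map_mx ratr C) kn.
  have : Num.sqrt (frob2 (map_mx ratr C - A x)) <= ratr e.
    by rewrite -[leRHS]gtr0_norm// -sqrtr_sqr ler_wsqrtr// ltW.
  by lra.
case=> -[C e] _ /=; rewrite /F/= => /andP[/andP[e0 qC] CA].
rewrite in_itv/= andbT.
have e0' : 0 < ratr e :> K by rewrite ltr0q.
have := singular_value_lipschitz (map_mx ratr C) (A x) kn.
have : Num.sqrt (frob2 (A x - map_mx ratr C)) <= ratr e.
  rewrite -[leRHS]gtr0_norm// -sqrtr_sqr ler_wsqrtr// ltW//.
  rewrite (_ : frob2 _ = frob2 (map_mx ratr C - A x))//.
  by apply: eq_bigr => i _; apply: eq_bigr => j _; rewrite !mxE -sqrrN opprB.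
by lra.
Qed.

End MeasurableSingularValue.

(** * Change of variables for a weighted measure *)

Section WeightedPushforward.
Local Open Scope classical_set_scope.
Local Open Scope ereal_scope.
Context d d' (X : measurableType d) (Y : measurableType d') (K : realType).
Variables (mu : {measure set X -> \bar K}) (nu : {measure set Y -> \bar K}).
Variables (w : X -> K) (phi : X -> Y) (c : K).
Hypothesis w0 : forall x, (0 <= w x)%R.
Hypotheses (mw : measurable_fun setT w) (mphi : measurable_fun setT phi).
Hypothesis wE : forall A, measurable A ->
  \int[mu]_x (w x * \1_A (phi x))%:E = c%:E * nu A.

Import HBNNSimple.

(** Extends [wE] from indicators to simple functions by linearity and then by monotone convergence.
    It serves both for products of independent factors and for the Gaussian density. *)
Lemma ge0_integral_weighted_pushforward (f : Y -> \bar K) :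
  measurable_fun setT f -> (forall y, 0 <= f y) ->
  \int[mu]_x ((w x)%:E * f (phi x)) = c%:E * \int[nu]_y f y.
Proof.
move=> mf f0; pose g := nnsfun_approx measurableT mf.
have gS n : \int[mu]_x (w x * g n (phi x))%:E = c%:E * \int[nu]_y (g n y)%:E.
  pose A r := (g n @^-1` [set r])%classic.
  have mA r : measurable (A r) by exact: measurable_sfunP.
  pose s := finmap.enum_fset (fset_set (range (g n))).
  (* The values of [g n] are nonnegative already; the truncation makes every coefficient visibly so,
     as exchanging sum and integral requires. *)
  have gE y : g n y = (\sum_(r <- s) Num.max r 0 * \1_(A r) y)%R.
    rewrite fimfunE fsbig_finite// big_seq [RHS]big_seq; apply: eq_bigr => r rs.
    rewrite max_l//; move: rs; rewrite in_fset_set// inE => -[x _ <-]//.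
  have r0 r : (0 <= Num.max r 0 :> K)%R by rewrite le_max lexx orbT.
  have i0 r y : (0 <= \1_(A r) y :> K)%R by [].
  have mi r : measurable_fun setT (\1_(A r) : Y -> K) by exact: measurable_indic.
  have m2 r : measurable_fun setT (fun x => (w x * \1_(A r) (phi x))%:E).
    apply/measurable_EFinP; apply: measurable_funM => //.
    exact: measurableT_comp.
  transitivity (\int[mu]_x \sum_(r <- s)
      (Num.max r 0)%:E * (w x * \1_(A r) (phi x))%:E).
    apply: eq_integral => x _; rewrite gE mulr_sumr -sumEFin.
    by apply: eq_bigr => r _; rewrite mulrCA EFinM.
  transitivity (c%:E * \int[nu]_y \sum_(r <- s)
      (Num.max r 0)%:E * (\1_(A r) y)%:E); last first.
    congr (_ * _); apply: eq_integral => y _; rewrite gE -sumEFin.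
    by apply: eq_bigr => r _; rewrite EFinM.
  rewrite !ge0_integral_sum//.
  - rewrite ge0_sume_distrr => [|r _]; last first.
      by apply: integral_ge0 => y _; rewrite mule_ge0 ?lee_fin.
    apply: eq_bigr => r _; rewrite ge0_integralZl_EFin//; last first.
      by move=> x _; rewrite lee_fin mulr_ge0.
    rewrite wE// ge0_integralZl_EFin//; last exact/measurable_EFinP.
    by rewrite integral_indic// setIT muleCA.
  - by move=> r; apply: measurable_funeM; exact/measurable_EFinP.
  - by move=> r y _; rewrite mule_ge0 ?lee_fin.
  - by move=> r; apply: measurable_funeM.
  - by move=> r x _; rewrite mule_ge0 ?lee_fin ?mulr_ge0.
have gf y : (g n y)%:E @[n --> \oo] --> f y by exact: cvg_nnsfun_approx.
have gnd y : {homo (fun n => (g n y)%:E) : a b / (a <= b)%N >-> a <= b}.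
  by move=> a b ab; rewrite lee_fin; exact/lefP/nd_nnsfun_approx.
have -> : \int[nu]_y f y = limn (fun n => \int[nu]_y (g n y)%:E).
  rewrite -monotone_convergence//.
  - by apply: eq_integral => y _; apply/esym/cvg_lim.
  - by move=> n; exact/measurable_EFinP.
  - by move=> n y _; rewrite lee_fin.
have -> : \int[mu]_x ((w x)%:E * f (phi x)) =
    limn (fun n => \int[mu]_x (w x * g n (phi x))%:E).
  rewrite -monotone_convergence//.
  - by apply: eq_integral => x _; apply/esym/cvg_lim => //;
    under eq_fun do rewrite EFinM; apply: cvgeZl => //; exact: gf.
  - move=> n; apply/measurable_EFinP/measurable_funM => //.
    exact: measurableT_comp.
  - by move=> n x _; rewrite lee_fin mulr_ge0.
  - by move=> x _ a b ab; rewrite !EFinM lee_wpmul2l ?lee_fin//; exact: gnd.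
under eq_fun do rewrite gS.
rewrite limeMl//; apply: ereal_nondecreasing_is_cvgn => a b ab.
apply: ge0_le_integral => //.
- by move=> y _; rewrite lee_fin.
- exact/measurable_EFinP.
- exact/measurable_EFinP.
- by move=> y _; exact: gnd.
Qed.

End WeightedPushforward.

(** * Independent Gaussian variables *)

Section IndependentProduct.
Local Open Scope classical_set_scope.
Local Open Scope ereal_scope.
Context d (Omega : measurableType d) (K : realType) (P : probability Omega K).
Context (I : finType) (X : I -> {RV P >-> K}).
Hypothesis indepX : mutually_independent X.

Let integral_indic_RV i A : measurable A ->
  \int[P]_w (\1_A (X i w))%:E = P (X i @^-1` A).
Proof.
move=> mA; rewrite -(setIT (X i @^-1` A)) -(integral_indic P measurableT)//.
by rewrite -[X in measurable X]setTI; exact: measurable_funP.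
Qed.

(** Induction on the number of factors that need not be indicators. With none left, this is the
    definition of independence. *)
Lemma integral_prod_indep_mixed (J : {set I}) (g : I -> K -> K) (m : I -> K) :
  (forall i, measurable_fun setT (g i)) -> (forall i x, (0 <= g i x)%R) ->
  (forall i, i \notin J -> exists2 A, measurable A & g i = \1_A) ->
  (forall i, \int[P]_w (g i (X i w))%:E = (m i)%:E) ->
  \int[P]_w (\prod_i g i (X i w))%:E = (\prod_i m i)%:E.
Proof.
have [n] := ubnP #|J|; elim: n J g m => // n IH J g m Jn mg g0 gJ gm.
have mgX i : measurable_fun setT (fun w => g i (X i w)).
  by apply: measurableT_comp.
have [J0|[j jJ]] := set_0Vmem J.
  have gA i : exists A, measurable A /\ g i = \1_A.
    by have [|A mA ->] := gJ i; [rewrite J0 inE|exists A].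
  pose A i := projT1 (cid (gA i)).
  have mA i : measurable (A i) by rewrite /A; case: cid => ? [].
  have gE i : g i = \1_(A i) by rewrite /A; case: cid => ? [].
  have PA i : P (X i @^-1` A i) = (m i)%:E.
    by rewrite -gm gE integral_indic_RV.
  have := indepX [set: I]%SET mA.
  rewrite (_ : (\prod_(i in _) _)%E = (\prod_i m i)%:E); last first.
    by rewrite -prodEFin; apply: eq_big => [i|i _]; rewrite ?inE ?PA.
  move=> <-; set B := [set w | _].
  have mB : measurable B.
    rewrite (_ : B = \bigcap_(i in [set: I]) (X i @^-1` A i)).
      apply: fin_bigcap_measurable => // i _.
      by rewrite -[X in measurable X]setTI; exact: measurable_funP.
    by apply/seteqP; split => w /= h i; [move=> _|move=> _]; apply: h; rewrite ?inE.
  rewrite -(setIT B) -(integral_indic P measurableT mB).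
  apply: eq_integral => w _; congr (_%:E).
  rewrite indicE; have [/set_mem Bw|Bw] := boolP (w \in B).
    rewrite big1// => i _; rewrite gE indicE mem_set//.
    by apply: Bw; rewrite inE.
  have [i Ai] : exists i, ~ A i (X i w).
    apply/existsNP => h; move/negP: Bw; apply; apply/mem_set => i _; exact: h.
  rewrite (bigD1 i)//= gE indicE memNset ?mul0r//.
(* The remaining factors are a weight. Replacing [g j] by an indicator removes [j] from [J], so the
   induction hypothesis identifies the weighted law of [X j], against which [g j] is then
   integrated. *)
pose w x := (\prod_(i | i != j) g i (X i x))%R.
have mw : measurable_fun setT w.
  rewrite /w; under eq_fun do rewrite -big_filter.
  by apply: measurable_prod => i _; exact: mgX.
have w0 x : (0 <= w x)%R by apply: prodr_ge0 => i _; exact: g0.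
pose c := (\prod_(i | i != j) m i)%R.
have wE A : measurable A ->
    \int[P]_x (w x * \1_A (X j x))%:E = c%:E * distribution P (X j) A.
  move=> mA.
  have PAfin : distribution P (X j) A \is a fin_num by exact: fin_num_measure.
  pose g' i := if i == j then \1_A else g i : K -> K.
  pose m' i := if i == j then fine (distribution P (X j) A) else m i.
  have g'E x : (w x * \1_A (X j x))%R = (\prod_i g' i (X i x))%R.
    rewrite (bigD1 j)//= /g' eqxx mulrC; congr (_ * _)%R.
    by apply: eq_bigr => i /negbTE ->.
  have m'E : c%:E * distribution P (X j) A = (\prod_i m' i)%:E.
    rewrite (bigD1 j)//= /m' eqxx mulrC EFinM fineK//; congr (_%:E * _).
    by apply: eq_bigr => i /negbTE ->.
  under eq_integral do rewrite g'E.
  rewrite m'E; apply: (IH (J :\ j)%SET).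
  - by move: Jn; rewrite (cardsD1 j) jJ ltnS.
  - by move=> i; rewrite /g'; case: ifP => // _; exact: measurable_indic.
  - by move=> i x; rewrite /g'; case: ifP => // _; exact: ge0_indic.
  - move=> i; rewrite /g' !inE; have [_ _|ij /=] := eqVneq i j; first by exists A.
    exact: gJ.
  - move=> i; rewrite /g' /m'; case: ifPn => [/eqP ->|_]; last exact: gm.
    by rewrite fineK// integral_indic_RV.
have := ge0_integral_weighted_pushforward w0 mw _ wE.
move=> /(_ _ (fun y => (g j y)%:E)); rewrite (bigD1 j)//= EFinM => h.
under eq_integral do rewrite (bigD1 j)//= mulrC EFinM.
rewrite h.
- rewrite ge0_integral_distribution ?gm 1?muleC//.
  + exact/measurable_EFinP.
  + by move=> y; rewrite lee_fin.
- exact: measurable_funP.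
- exact/measurable_EFinP.
- by move=> y; rewrite lee_fin.
Qed.

Lemma integral_prod_indep (g : I -> K -> K) (m : I -> K) :
  (forall i, measurable_fun setT (g i)) -> (forall i x, (0 <= g i x)%R) ->
  (forall i, \int[P]_w (g i (X i w))%:E = (m i)%:E) ->
  \int[P]_w (\prod_i g i (X i w))%:E = (\prod_i m i)%:E.
Proof.
move=> mg g0 gm; apply: (@integral_prod_indep_mixed [set: I]%SET) => // i.
by rewrite inE.
Qed.

End IndependentProduct.

(** * Gaussian exponential integrals *)

Section GaussianExponential.
Local Open Scope classical_set_scope.
Context d (Omega : measurableType d) (K : realType) (P : probability Omega K).
Variables (s : K) (X : {RV P >-> K}).
Hypothesis s_gt0 : 0 < s.
Hypothesis normalX : forall A, measurable A -> distribution P X A = normal_prob 0 s A.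

(** Completing the square: the tilted density is a multiple of another normal density, so its
    integral can be read off. *)
Lemma normal_pdf_tilt (b a x : K) : 0 <= a ->
  normal_pdf 0 s x * expR (b * (x / s) - a / 2 * (x / s) ^+ 2) =
  (Num.sqrt (1 + a))^-1 * expR (b ^+ 2 / (2 * (1 + a))) *
    normal_pdf (b * s / (1 + a)) (s / Num.sqrt (1 + a)) x.
Proof.
move=> a0; have a1 : 0 < 1 + a by rewrite ltr_wpDr.
have q0 : Num.sqrt (1 + a) != 0 by rewrite sqrtr_eq0 -ltNge.
have s0 : s != 0 by rewrite gt_eqF.
rewrite !normal_pdfE ?mulf_neq0 ?invr_eq0//= /normal_peak /normal_fun.
rewrite -[LHS]mulrA -expRD [RHS]mulrACA -expRD.
have -> : (s / Num.sqrt (1 + a)) ^+ 2 = s ^+ 2 / (1 + a).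
  by rewrite expr_div_n sqr_sqrtr// ltW.
rewrite -invfM; congr (_^-1 * expR _).
  rewrite -sqrtrM; last by rewrite ltW.
  have -> : s ^+ 2 * pi *+ 2 = (1 + a) * (s ^+ 2 / (1 + a) * pi *+ 2).
    rewrite mulrnAr; congr (_ *+ 2).
    by rewrite -mulrA mulrCA (mulrA (1 + a)) mulfV ?mul1r// gt_eqF.
  by [].
rewrite -(mulr_natr (s ^+ 2)) -(mulr_natr (s ^+ 2 / (1 + a))).
by field; rewrite gt_eqF.
Qed.

Lemma gaussian_exp_quadratic (b a : K) : 0 <= a ->
  (\int[P]_w (expR (b * (X w / s) - a / 2 * (X w / s) ^+ 2))%:E =
  ((Num.sqrt (1 + a))^-1 * expR (b ^+ 2 / (2 * (1 + a))))%:E)%E.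
Proof.
move=> a0; pose f x := (expR (b * (x / s) - a / 2 * (x / s) ^+ 2)).
have mf : measurable_fun setT f.
  have mxs : measurable_fun setT (fun x : K => x / s) by exact: measurable_funM.
  apply: measurableT_comp => //; apply: measurable_funB; apply: measurable_funM => //.
  exact: measurable_funX.
have mfE : measurable_fun setT (EFin \o f) by exact/measurable_EFinP.
have fE0 x : (0 <= (EFin \o f) x)%E by rewrite lee_fin expR_ge0.
rewrite -(ge0_integral_distribution X mfE fE0).
(* The weight is the normal density with respect to Lebesgue measure, and the map is the
   identity. *)
have := @ge0_integral_weighted_pushforward _ _ (measurableTypeR K) K K
  lebesgue_measure (distribution P X) (normal_pdf 0 s) (fun x => x) 1.
move=> /(_ (normal_pdf_ge0 _ _) (measurable_normal_pdf _ _)).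
move=> /(_ _ _ _ mfE fE0); rewrite mul1e => <-; last 2 first.
- by move=> _ A mA; rewrite setTI.
- move=> A mA; rewrite mul1e -[RHS]/(distribution P X A) normalX// /normal_prob.
  rewrite [RHS]integral_mkcond.
  by apply: eq_integral => x _; rewrite epatch_indic EFinM.
under eq_integral do rewrite /= -EFinM /f normal_pdf_tilt// EFinM.
rewrite ge0_integralZl_EFin//.
- by rewrite integral_normal_pdf mule1.
- by move=> x _; rewrite lee_fin normal_pdf_ge0.
- by apply/measurable_EFinP; exact: measurable_normal_pdf.
Qed.

End GaussianExponential.

Section Numeric.
Variable K : realType.

(** As [29 / 20 = 7 / 10 + 3 / 4], this says that [ln 4 - 3 / 4 <= 7 / 10]. It follows from
    [1 + x <= expR x] at [29 / 320], raised to the power 16. *)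
Lemma expR_lower4 : 4 <= expR (29 / 20) :> K.
Proof.
have -> : 29 / 20 = (29 / 320) * 16%:R :> K by field.
rewrite expRM_natr; apply: (@le_trans _ _ ((1 + 29 / 320) ^+ 16)).
  have sq (a b x : K) : 0 <= a -> b <= a ^+ 2 -> a <= x -> b <= x ^+ 2.
    by move=> a0 ba ax; rewrite (le_trans ba)// lerXn2r ?nnegrE// (le_trans a0).
  (* Four successive squarings, with decimal lower bounds for the powers 8, 4 and 2. *)
  rewrite (exprM _ 8 2) (exprM _ 4 2) (exprM _ 2 2).
  apply: (sq (2001 / 1000)); [lra|lra|apply: (sq (14146 / 10000)); [lra|lra|]].
  by apply: (sq (11894 / 10000)); lra.
apply: lerXn2r; rewrite ?nnegrE ?expR_ge0 ?expR_ge1Dx//.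
Qed.

(* The tangent of [ln] at 4 bounds the normalization ([7 / 10] bounds [ln 4 - 3 / 4]),
   completing the square bounds the exponential. *)
Lemma gaussian_factor_lower (a w B : K) : 0 <= w ->
  expR (a * B - a ^+ 2 * (1 + w) / 2 - (w / 4 + 7 / 10) / 2) <=
  (Num.sqrt (1 + w))^-1 * expR (B ^+ 2 / (2 * (1 + w))).
Proof.
move=> w0; have w1 : 0 < 1 + w by rewrite ltr_wpDr.
rewrite expRD mulrC ler_pM ?expR_ge0//; last first.
  rewrite ler_expR -subr_ge0.
  have -> : B ^+ 2 / (2 * (1 + w)) - (a * B - a ^+ 2 * (1 + w) / 2) =
      (B - a * (1 + w)) ^+ 2 / (2 * (1 + w)) by field; rewrite gt_eqF.
  by rewrite divr_ge0 ?sqr_ge0// mulr_ge0// ltW.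
rewrite expRN lef_pV2 ?posrE ?expR_gt0 ?sqrtr_gt0//.
rewrite -[leRHS]gtr0_norm ?expR_gt0// -sqrtr_sqr ler_wsqrtr//.
rewrite -expRM_natr divfK//.
have -> : w / 4 + 7 / 10 = (29 / 20 + ((1 + w) / 4 - 1)) by field.
rewrite expRD; have := expR_ge1Dx ((1 + w) / 4 - 1); have := expR_lower4.
set x := expR (29 / 20); set y := expR _ => x4 y1.
apply: (@le_trans _ _ (4 * ((1 + w) / 4))); first by lra.
by rewrite ler_pM//; [rewrite divr_ge0// ltW|lra].
Qed.

End Numeric.

Section GaussianFamily.
Local Open Scope classical_set_scope.
Context d (Omega : measurableType d) (K : realType) (P : probability Omega K).

Lemma mutually_independent_comp (I J : finType) (X : I -> {RV P >-> K}) (f : J -> I) :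
  injective f -> mutually_independent X -> mutually_independent (fun j => X (f j)).
Proof.
move=> f_inj indepX L A mA.
(* The sets are transported to the image of [f] and extended by the whole line elsewhere. *)
pose A' i := if [pick j | f j == i] is Some j then A j else setT.
have A'f j : A' (f j) = A j.
  rewrite /A'; case: pickP => [k /eqP/f_inj->//|/(_ j)]; by rewrite eqxx.
have mA' i : measurable (A' i) by rewrite /A'; case: pickP.
have := indepX (f @: L)%SET A' mA'.
rewrite big_imset/=; last by move=> x y _ _; exact: f_inj.
under eq_bigr do rewrite A'f.
move=> <-; congr (P _); apply/seteqP; split => w /= h.
  by move=> i /imsetP[j jL ->]; rewrite A'f; exact: h.
by move=> j jL; rewrite -A'f; apply: h; exact: imset_f.
Qed.

Definition normal_iid (I : finType) (s : K) (X : I -> {RV P >-> K}) :=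
  mutually_independent X /\
  forall i A, measurable A -> distribution P (X i) A = normal_prob 0 s A.

Lemma normal_iid_comp (I J : finType) s (X : I -> {RV P >-> K}) (f : J -> I) :
  injective f -> normal_iid s X -> normal_iid s (fun j => X (f j)).
Proof.
by move=> f_inj [indepX nX]; split => [|j A mA]; [exact: mutually_independent_comp|exact: nX].
Qed.

Variables (s : K) (s_gt0 : 0 < s).

Let measurable_quad (b a : K) :
  measurable_fun setT (fun x : K => expR (b * (x / s) - a / 2 * (x / s) ^+ 2)).
Proof.
have mxs : measurable_fun setT (fun x : K => x / s) by exact: measurable_funM.
apply: measurableT_comp => //; apply: measurable_funB; apply: measurable_funM => //.
exact: measurable_funX.
Qed.

Lemma integral_expR_linear (I : finType) (X : I -> {RV P >-> K}) (c : I -> K) :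
  normal_iid s X ->
  (\int[P]_w (expR (\sum_i c i * (X i w / s) - (\sum_i c i ^+ 2) / 2))%:E = 1)%E.
Proof.
move=> [indepX nX].
pose g i x := expR (c i * (x / s) - 0 / 2 * (x / s) ^+ 2).
pose m i := expR (c i ^+ 2 / 2).
have gm i : (\int[P]_w (g i (X i w))%:E = (m i)%:E)%E.
  by rewrite (gaussian_exp_quadratic s_gt0 (nX i))// addr0 sqrtr1 invr1 mul1r mulr1.
have gE w : expR (\sum_i c i * (X i w / s) - (\sum_i c i ^+ 2) / 2) =
    expR (- ((\sum_i c i ^+ 2) / 2)) * \prod_i g i (X i w).
  rewrite expRD mulrC expR_sum; congr (_ * _); apply: eq_bigr => i _.
  by rewrite /g mul0r mul0r subr0.
under eq_integral do rewrite gE EFinM.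
rewrite ge0_integralZl_EFin ?expR_ge0//.
- rewrite (integral_prod_indep indepX _ _ gm) => [| |i x]; last exact: expR_ge0.
    rewrite -EFinM -expR_sum -expRD -mulr_suml addNr expR0//.
  by move=> i; exact: measurable_quad.
- by move=> w _; rewrite lee_fin prodr_ge0// => i _; exact: expR_ge0.
- apply/measurable_EFinP; apply: measurable_prod => i _.
  by apply: measurableT_comp => //; exact: measurable_quad.
Qed.

(** The variational bound for a trial Gaussian of mean [a] and coordinate variance [1 / 4]: the
    exponent is its average under the trial law minus an upper bound for the relative entropy. The
    vector [a] remains free. *)
Lemma integral_expR_quadratic_lower (I : finType) (X : I -> {RV P >-> K})
    (b a : I -> K) (q : K) : 0 <= q -> normal_iid s X ->
  ((expR (\sum_i a i * b i - (\sum_i a i ^+ 2) * (1 + q) / 2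
      - #|I|%:R * (q / 4 + 7 / 10) / 2))%:E <=
  \int[P]_w (expR (\sum_i b i * (X i w / s) - q / 2 * \sum_i (X i w / s) ^+ 2))%:E)%E.
Proof.
move=> q0 [indepX nX].
pose g i x := expR (b i * (x / s) - q / 2 * (x / s) ^+ 2).
pose m i := (Num.sqrt (1 + q))^-1 * expR (b i ^+ 2 / (2 * (1 + q))).
have gm i : (\int[P]_w (g i (X i w))%:E = (m i)%:E)%E.
  by rewrite (gaussian_exp_quadratic s_gt0 (nX i)).
have gE w : expR (\sum_i b i * (X i w / s) - q / 2 * \sum_i (X i w / s) ^+ 2) =
    \prod_i g i (X i w).
  by rewrite mulr_sumr -sumrB expR_sum.
under eq_integral do rewrite gE.
rewrite (integral_prod_indep indepX _ _ gm) => [| |i x]; last exact: expR_ge0.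
  rewrite lee_fin.
  have -> : #|I|%:R * (q / 4 + 7 / 10) / 2 = \sum_(i : I) (q / 4 + 7 / 10) / 2 :> K.
    by rewrite sumr_const -[RHS]mulr_natl mulrA.
  rewrite !mulr_suml -!sumrB expR_sum; apply: ler_prod => i _.
  by rewrite expR_ge0 gaussian_factor_lower.
by move=> i; exact: measurable_quad.
Qed.

End GaussianFamily.

(** * The norm of a Gaussian matrix on a subspace *)

Section GaussianMatrixNorm.
Local Open Scope classical_set_scope.
Context d (Omega : measurableType d) (K : realType) (P : probability Omega K).
Variables (I : finType) (s : K) (X : I -> {RV P >-> K}).
Hypotheses (s_gt0 : 0 < s) (iidX : normal_iid s X).
Variables (m n D : nat) (phi : 'I_m * 'I_n -> I) (alpha : 'I_m -> I) (gamma : 'I_D -> I).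
Hypotheses (phi_inj : injective phi) (alpha_inj : injective alpha)
  (gamma_inj : injective gamma).
Variables (B : 'M[K]_(n, D)).
Hypothesis BB : B^T *m B = 1%:M.
Variables (ah ag : K).

Definition standardized_mx w : 'M[K]_(m, n) := \matrix_(p, q) (X (phi (p, q)) w / s).
Local Notation G := standardized_mx.

(** The mixing vectors reuse variables of the family [X], at sample points of their own; [ah] and
    [ag] are their scales. *)
Definition left_mixing_vector w : 'cV[K]_m := \col_p (ah * (X (alpha p) w / s)).
Local Notation h := left_mixing_vector.

Definition right_mixing_vector w : 'cV[K]_D := \col_j (ag * (X (gamma j) w / s)).
Local Notation g := right_mixing_vector.

Definition mixture_exponent w (z : Omega * Omega) : K :=
  dotv (h z.1) (G w *m (B *m g z.2)) - dotv (h z.1) (h z.1) * dotv (g z.2) (g z.2) / 2.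
Local Notation Z := mixture_exponent.

Let PP := product_subprobability (P : subprobability Omega K, P : subprobability Omega K).

(* [z] runs over two independent copies of [Omega], which carry the mixing vectors. *)
Definition exponential_mixture w : \bar K := (\int[PP]_z (expR (Z w z))%:E)%E.
Local Notation Phi := exponential_mixture.

Let mX i : measurable_fun setT (fun w => X i w / s).
Proof. exact: measurable_funM. Qed.

Let measurable_Z : measurable_fun setT (fun wz : Omega * (Omega * Omega) => Z wz.1 wz.2).
Proof.
have mh p : measurable_fun setT (fun wz : Omega * (Omega * Omega) => h wz.2.1 p 0).
  under eq_fun do rewrite mxE; apply: measurable_funM => //.
  by apply: (measurableT_comp (mX _)); apply: measurableT_comp.
have mg j : measurable_fun setT (fun wz : Omega * (Omega * Omega) => g wz.2.2 j 0).
  under eq_fun do rewrite mxE; apply: measurable_funM => //.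
  by apply: (measurableT_comp (mX _)); apply: measurableT_comp.
have mG p q : measurable_fun setT (fun wz : Omega * (Omega * Omega) => G wz.1 p q).
  under eq_fun do rewrite mxE.
  by apply: (measurableT_comp (mX _)).
apply: measurable_funB.
  apply: measurable_sum => p; apply: measurable_funM => //.
  under eq_fun do rewrite mxE; apply: measurable_sum => q.
  apply: measurable_funM => //; under eq_fun do rewrite mxE.
  by apply: measurable_sum => j; apply: measurable_funM.
apply: measurable_funM => //; apply: measurable_funM.
  by apply: measurable_sum => p; apply: measurable_funM.
by apply: measurable_sum => p; apply: measurable_funM.
Qed.

Let measurable_expZ : measurable_fun setT
  (fun wz : Omega * (Omega * Omega) => (expR (Z wz.1 wz.2))%:E).
Proof. by apply/measurable_EFinP; apply: measurableT_comp. Qed.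

Lemma measurable_mixture : measurable_fun setT Phi.
Proof.
apply: (measurable_fun_fubini_tonelli_F (m2 := PP)
  (fun wz : Omega * (Omega * Omega) => (expR (Z wz.1 wz.2))%:E)) => //.
Qed.

(** By Tonelli the matrix is averaged first. For fixed [h] and [g] the exponent is linear in its
    entries, with coefficients [h_p (B g)_q] whose squares sum to [|h|^2 |g|^2] because [B] is an
    isometry; the average is therefore 1. *)
Lemma integral_mixture_le1 : (\int[P]_w Phi w <= 1)%E.
Proof.
have -> : (\int[P]_w Phi w = \int[PP]_z \int[P]_w (expR (Z w z))%:E)%E.
  apply: (fubini_tonelli (m1 := P) (m2 := PP)
    (fun wz : Omega * (Omega * Omega) => (expR (Z wz.1 wz.2))%:E)) => //.
have E z : (\int[P]_w (expR (Z w z))%:E = 1)%E.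
  pose c pq := h z.1 pq.1 0 * (B *m g z.2) pq.2 0.
  have ZE w : Z w z =
      \sum_i c i * (X (phi i) w / s) - (\sum_i c i ^+ 2) / 2.
    rewrite /Z; congr (_ - _ / 2).
      transitivity (\sum_p \sum_q c (p, q) * (X (phi (p, q)) w / s)); last first.
        by rewrite pair_bigA; apply: eq_bigr => -[].
      apply: eq_bigr => p _; rewrite [(G w *m _) p 0]mxE mulr_sumr.
      by apply: eq_bigr => q _; rewrite [G w p q]mxE /c /= -[RHS]mulrA;
        congr (_ * _); exact: mulrC.
    rewrite -(isometry_dotv (g z.2) BB) /dotv big_distrlr/= pair_bigA/=.
    by apply: eq_bigr => -[p q] _; rewrite /c/= exprMn !expr2.
  under eq_integral do rewrite ZE.
  exact: (integral_expR_linear s_gt0 c (normal_iid_comp phi_inj iidX)).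
under eq_integral do rewrite E.
by rewrite integral_cst// mul1e; exact: sprobability_setT.
Qed.

(** The variational bound is used twice: for [h] with trial mean [b *: u], then for [g] with trial
    mean of length [a] in the direction of [B^T G^T u]. *)
Lemma mixture_lower w (u : 'cV[K]_m) (a b : K) :
  let y := enorm (B^T *m ((G w)^T *m u)) in
  enorm u = 1 -> 0 < y -> 0 < ah -> 0 < ag -> 0 <= a -> 0 <= b ->
  ((expR (a * b * y - (b ^+ 2 + m%:R * ah ^+ 2 / 4) * (a ^+ 2 + D%:R * ag ^+ 2 / 4) / 2
     - a ^+ 2 / (2 * ag ^+ 2) - b ^+ 2 / (2 * ah ^+ 2) - 7 / 20 * (m + D)%:R))%:E <= Phi w)%E.
Proof.
move=> y u1 y0 ah0 ag0 a0 b0.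
set yv := B^T *m ((G w)^T *m u) in y y0 *.
(* The second moment of [h] under its trial law; it multiplies [|g|^2 / 2] once [h] is integrated
   out. *)
pose c := b ^+ 2 + m%:R * ah ^+ 2 / 4.
have c0 : 0 <= c by rewrite addr_ge0 ?sqr_ge0// divr_ge0// mulr_ge0 ?sqr_ge0.
pose F (z : Omega * Omega) := (expR (Z w z))%:E.
have mF : measurable_fun setT F.
  exact: (measurableT_comp measurable_expZ (measurable_pair1 _)).
have F0 z : (0 <= F z)%E by rewrite lee_fin expR_ge0.
have -> : Phi w = (\int[P]_y0 \int[P]_x0 F (x0, y0))%E.
  exact: (fubini_tonelli2 (m1 := P) (m2 := P)).
(* The entropy cost of the trial law of [h]; what still depends on [g] is collected in [lin]. *)
pose k := - (b ^+ 2 / (2 * ah ^+ 2) + 7 / 20 * m%:R).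
pose lin w' := expR (\sum_j b * ag * yv j 0 * (X (gamma j) w' / s)
  - c * ag ^+ 2 / 2 * \sum_j (X (gamma j) w' / s) ^+ 2).
have uu : \sum_p u p 0 ^+ 2 = 1.
  rewrite (_ : \sum_p _ = dotv u u); first by rewrite -sqr_enorm u1 expr1n.
  by apply: eq_bigr => p _; rewrite expr2.
have inner w' : ((expR k * lin w')%:E <= \int[P]_x0 F (x0, w'))%E.
  pose z := G w *m (B *m g w'); pose q := dotv (g w') (g w').
  have q0 : 0 <= ah ^+ 2 * q by rewrite mulr_ge0 ?sqr_ge0// dotvv_ge0.
  have := integral_expR_quadratic_lower s_gt0 (fun p => ah * z p 0)
    (fun p => b * u p 0 / ah) q0 (normal_iid_comp alpha_inj iidX).
  have ZE x0 : Z w (x0, w') = \sum_p ah * z p 0 * (X (alpha p) x0 / s)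
      - ah ^+ 2 * q / 2 * \sum_p (X (alpha p) x0 / s) ^+ 2.
    rewrite /Z -/z -/q; congr (_ - _).
      by apply: eq_bigr => p _; rewrite mxE mulrAC.
    have -> : dotv (h x0) (h x0) = ah ^+ 2 * \sum_p (X (alpha p) x0 / s) ^+ 2.
      by rewrite mulr_sumr; apply: eq_bigr => p _; rewrite mxE -expr2 exprMn.
    by rewrite -!mulrA; do 2 congr (_ * _); rewrite mulrC -mulrA.
  under [X in (_ <= X)%E -> _]eq_integral do rewrite -ZE.
  apply: le_trans; rewrite lee_fin /lin -expRD ler_expR card_ord.
  have -> : \sum_p b * u p 0 / ah * (ah * z p 0) =
      \sum_j b * ag * yv j 0 * (X (gamma j) w' / s).
    transitivity (b * dotv u z).
      rewrite mulr_sumr; apply: eq_bigr => p _.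
      by rewrite [LHS]mulrA divfK ?gt_eqF// -mulrA.
    have -> : dotv u z = dotv yv (g w') by rewrite /yv !dotv_mulmxl !trmxK.
    by rewrite mulr_sumr; apply: eq_bigr => j _; rewrite [g w' j 0]mxE; ring.
  have -> : \sum_p (b * u p 0 / ah) ^+ 2 = b ^+ 2 / ah ^+ 2.
    rewrite -[RHS]mulr1 -uu mulr_sumr; apply: eq_bigr => p _.
    by rewrite !exprMn exprVn mulrAC.
  have -> : q = ag ^+ 2 * \sum_j (X (gamma j) w' / s) ^+ 2.
    by rewrite /q mulr_sumr; apply: eq_bigr => j _; rewrite mxE -expr2 exprMn.
  set L := \sum_j _; set S := \sum_j _; rewrite le_eqVlt; apply/orP; left.
  by apply/eqP; rewrite /k /c; field; rewrite gt_eqF.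
have mlin : measurable_fun setT (fun w' => (lin w')%:E).
  apply/measurable_EFinP; apply: measurableT_comp => //; apply: measurable_funB.
    by apply: measurable_sum => j; apply: measurable_funM.
  apply: measurable_funM => //; apply: measurable_sum => j.
  exact: measurable_funX.
apply: (@le_trans _ _ (\int[P]_w' (expR k * lin w')%:E)%E); last first.
  apply: ge0_le_integral => //.
  - by move=> w' _; rewrite lee_fin mulr_ge0 ?expR_ge0.
  - by under eq_fun do rewrite EFinM; apply: measurable_funeM.
  - exact: (measurable_fun_fubini_tonelli_G (m1 := P)).
under eq_integral do rewrite EFinM.
rewrite ge0_integralZl_EFin ?expR_ge0//; last by move=> w' _; rewrite lee_fin expR_ge0.
have q0 : 0 <= c * ag ^+ 2 by rewrite mulr_ge0 ?sqr_ge0.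
have := integral_expR_quadratic_lower s_gt0 (fun j => b * ag * yv j 0)
  (fun j => a * yv j 0 / (y * ag)) q0 (normal_iid_comp gamma_inj iidX).
rewrite -/(lin _) => h1.
apply: (@le_trans _ _ ((expR k)%:E * (expR (a * b * y - a ^+ 2 / ag ^+ 2 * (1 + c * ag ^+ 2) / 2
    - D%:R * (c * ag ^+ 2 / 4 + 7 / 10) / 2))%:E)%E).
  rewrite -EFinM -expRD lee_fin ler_expR le_eqVlt; apply/orP; left.
  by apply/eqP; rewrite /k /c natrD; field; rewrite !gt_eqF.
rewrite lee_pmul2l ?lte_fin ?expR_gt0//; apply: le_trans h1.
have yy : \sum_j yv j 0 ^+ 2 = y ^+ 2.
  by rewrite sqr_enorm; apply: eq_bigr => j _; rewrite expr2.
rewrite lee_fin ler_expR card_ord.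
have -> : \sum_j a * yv j 0 / (y * ag) * (b * ag * yv j 0) = a * b * y.
  have -> : a * b * y = a * b / y * \sum_j yv j 0 ^+ 2 by rewrite yy; field; rewrite gt_eqF.
  by rewrite mulr_sumr; apply: eq_bigr => j _; field; rewrite !gt_eqF.
have -> // : \sum_j (a * yv j 0 / (y * ag)) ^+ 2 = a ^+ 2 / ag ^+ 2.
have -> : a ^+ 2 / ag ^+ 2 = a ^+ 2 / (y * ag) ^+ 2 * \sum_j yv j 0 ^+ 2.
  by rewrite yy; field; rewrite !gt_eqF.
by rewrite mulr_sumr; apply: eq_bigr => j _; field; rewrite !gt_eqF.
Qed.

End GaussianMatrixNorm.

(* The constants 8/5 and 3/4 linearize the exact threshold in [b ^+ 2], so that the two
   thresholds with [b ^+ 2 + b' ^+ 2 = N ^+ 2 + 1] add up to at most [4 * N + 2 * t]. *)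
Lemma tail_exponent (K : realType) (N b m D t y : K) : 0 < N -> 0 < b -> 0 <= t ->
  0 <= m <= N ^+ 2 -> 0 <= D <= b ^+ 2 -> 8 / 5 * N + 3 / 4 * (b ^+ 2 / N) + t <= y ->
  exists2 x, 0 <= x &
  t ^+ 2 / 2 <= x * y - (x + m * (2 / N) / 4) * (x + D * (2 / b) / 4) / 2
    - x / (2 * (2 / b)) - x / (2 * (2 / N)) - 7 / 20 * (m + D).
Proof.
move=> N0 b0 t0 /andP[m0 mN] /andP[D0 Db] sy.
pose r := b ^+ 2 / N; have rN : r * N = b ^+ 2 by rewrite divfK ?gt_eqF.
have r0 : 0 <= r by rewrite divr_ge0 ?sqr_ge0 ?ltW.
(* The threshold without [t], less the [(N + b) / 2] that the linear costs consume. *)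
pose k := 11 / 10 * N - b / 2 + 3 / 4 * r.
(* A square, a positive definite form in [N] and [b], and a multiple of [r * N - b ^+ 2 = 0]. *)
have kk : k ^+ 2 - (N * b / 4 + 7 / 10 * (N ^+ 2 + b ^+ 2)) =
    (3 / 4 * r - b / 2 + N / 10) ^+ 2 + (4 / 5 * b ^+ 2 - 5 / 4 * (N * b) + N ^+ 2 / 2) +
    3 / 2 * (r * N - b ^+ 2).
  by rewrite /k; field.
have k2 : N * b / 4 + 7 / 10 * (N ^+ 2 + b ^+ 2) <= k ^+ 2.
  rewrite -subr_ge0 kk rN subrr mulr0 addr0 addr_ge0 ?sqr_ge0//.
  have -> : 4 / 5 * b ^+ 2 - 5 / 4 * (N * b) + N ^+ 2 / 2 =
    4 / 5 * (b - 25 / 32 * N) ^+ 2 + 3 / 256 * N ^+ 2 by field.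
  by rewrite addr_ge0// mulr_ge0 ?sqr_ge0.
have k0 : 0 <= k.
  have : 0 <= (b - N) ^+ 2 * (3 / 4) / N + b + N * (7 / 20).
    apply: addr_ge0; first apply: addr_ge0; [|exact: ltW|].
      by apply: divr_ge0; [rewrite mulr_ge0 ?sqr_ge0|exact: ltW].
    by rewrite mulr_ge0// ltW.
  have -> : (b - N) ^+ 2 * (3 / 4) / N + b + N * (7 / 20) = k.
    by rewrite /k /r; field; rewrite gt_eqF.
  by [].
(* With [x = t + k] the exponent is at least [(x ^+ 2 - k ^+ 2) / 2], and
   [x ^+ 2 >= t ^+ 2 + k ^+ 2]. *)
exists (t + k); first by rewrite addr_ge0.
set x := t + k; have x0 : 0 <= x by rewrite addr_ge0.
have yx : (N + b) / 2 + x <= y.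
  by move: sy; rewrite -/r; apply: le_trans; rewrite /x /k; lra.
have hm : m * (2 / N) / 4 <= N / 2.
  have -> : m * (2 / N) / 4 = m / N / 2 by field; rewrite gt_eqF.
  by rewrite ler_pM2r ?invr_gt0// ler_pdivrMr// -expr2.
have hD : D * (2 / b) / 4 <= b / 2.
  have -> : D * (2 / b) / 4 = D / b / 2 by field; rewrite gt_eqF.
  by rewrite ler_pM2r ?invr_gt0// ler_pdivrMr// -expr2.
have m1 : 0 <= m * (2 / N) / 4 by rewrite divr_ge0// mulr_ge0// divr_ge0// ltW.
have D1 : 0 <= D * (2 / b) / 4 by rewrite divr_ge0// mulr_ge0// divr_ge0// ltW.
have h1 : (x + m * (2 / N) / 4) * (x + D * (2 / b) / 4) <= (x + N / 2) * (x + b / 2).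
  by apply: ler_pM; [exact: addr_ge0|exact: addr_ge0|rewrite lerD2l|rewrite lerD2l].
have h2 : x * ((N + b) / 2 + x) <= x * y by rewrite ler_wpM2l.
have h3 : t ^+ 2 + k ^+ 2 <= x ^+ 2.
  by rewrite /x sqrrD; have := mulr_ge0 t0 k0; rewrite -subr_ge0; lra.
have -> : x / (2 * (2 / b)) = x * b / 4 by field; rewrite gt_eqF.
have -> : x / (2 * (2 / N)) = x * N / 4 by field; rewrite gt_eqF.
move: h1 h2 h3 k2 mN Db; move: (_ * (x + D * _ / 4)) => W.
clear -K; move=> h1 h2 h3 k2 mN Db; nra.
Qed.


Section GaussianMatrixTail.
Local Open Scope classical_set_scope.
Context d (Omega : measurableType d) (K : realType) (P : probability Omega K).
Variables (I : finType) (s : K) (X : I -> {RV P >-> K}).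
Hypotheses (s_gt0 : 0 < s) (iidX : normal_iid s X).

(** [A] is a superlevel set of the mixture, hence one event for all [v] at once. Markov's inequality
    bounds its probability, and [mixture_lower] shows that one stretched direction forces it. *)
Lemma gaussian_matrix_tail (m n D : nat) (phi : 'I_m * 'I_n -> I)
    (alpha : 'I_m -> I) (gamma : 'I_D -> I) (B : 'M[K]_(n, D)) (N b t : K) :
  injective phi -> injective alpha -> injective gamma -> B^T *m B = 1%:M ->
  0 < N -> 0 < b -> 0 <= t -> m%:R <= N ^+ 2 -> D%:R <= b ^+ 2 ->
  exists A : set Omega, [/\ measurable A, (P A <= (expR (- (t ^+ 2 / 2)))%:E)%E &
    forall w v, v != 0 ->
      s * (8 / 5 * N + 3 / 4 * (b ^+ 2 / N) + t) * enorm v <=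
      enorm ((\matrix_(p, q) X (phi (p, q)) w) *m (B *m v)) -> A w].
Proof.
move=> phi_inj alpha_inj gamma_inj BB N0 b0 t0 mN Db.
(* These scales balance the two costs: [m * ah ^+ 2 / 4 <= N / 2] and
   [x / (2 * ah ^+ 2) = x * N / 4], likewise for [ag] with [D] and [b]. *)
pose ah := Num.sqrt (2 / N); pose ag := Num.sqrt (2 / b).
have ah2 : ah ^+ 2 = 2 / N by rewrite sqr_sqrtr// divr_ge0// ltW.
have ag2 : ag ^+ 2 = 2 / b by rewrite sqr_sqrtr// divr_ge0// ltW.
have ah0 : 0 < ah by rewrite sqrtr_gt0 divr_gt0.
have ag0 : 0 < ag by rewrite sqrtr_gt0 divr_gt0.
pose Phi := exponential_mixture s X phi alpha gamma B ah ag.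
have mPhi : measurable_fun setT Phi by exact: measurable_mixture.
have Phi0 w : (0 <= Phi w)%E by apply: integral_ge0 => z _; rewrite lee_fin expR_ge0.
pose A := [set w | ((expR (t ^+ 2 / 2))%:E <= Phi w)%E].
have mA : measurable A.
  by rewrite /A -[X in measurable X]setTI; exact: (emeasurable_fun_c_infty measurableT mPhi).
exists A; split => //.
  have h : ((expR (t ^+ 2 / 2))%:E * P A <= 1)%E.
    apply: le_trans (integral_mixture_le1 s_gt0 iidX alpha gamma phi_inj BB ah ag).
    rewrite -(setIT A) -(integral_indic P measurableT mA).
    rewrite -ge0_integralZl_EFin ?expR_ge0//; last exact/measurable_EFinP/measurable_indic.
    apply: ge0_le_integral => //.
    - by apply: measurable_funeM; exact/measurable_EFinP/measurable_indic.
    - move=> w _; rewrite indicE; have [/set_mem|] := boolP (w \in A).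
        by rewrite mule1.
      by rewrite mule0.
  have PA : P A \is a fin_num by exact: fin_num_measure.
  move: h; rewrite -(fineK PA) -EFinM !lee_fin expRN => h.
  by rewrite -[leRHS]mulr1 ler_pdivlMl ?expR_gt0.
move=> w v v0; set s0 := _ + t => h.
pose G := standardized_mx s X phi w.
have s00 : 0 < s0.
  rewrite /s0 ltr_wpDr// addr_gt0// mulr_gt0// ?divr_gt0// exprn_gt0//.
have GE : \matrix_(p, q) X (phi (p, q)) w = s *: G.
  by apply/matrixP => p q; rewrite !mxE mulrC divfK// gt_eqF.
have e0 := enorm_gt0 v0.
have hG : s0 * enorm v <= enorm (G *m (B *m v)).
  by move: h; rewrite GE -scalemxAl enormZ gtr0_norm// -mulrA ler_pM2l.
pose z := G *m (B *m v).
have z0 : 0 < enorm z by apply: lt_le_trans hG; rewrite mulr_gt0.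
(* The output direction: by Cauchy-Schwarz the transpose stretches [u] at least as much as [G *m B]
   stretches [v]. *)
pose u := (enorm z)^-1 *: z.
have u1 : enorm u = 1 by rewrite enormZ gtr0_norm ?invr_gt0// mulVf// gt_eqF.
pose y := enorm (B^T *m (G^T *m u)).
have sy : s0 <= y.
  rewrite -(ler_pM2r e0); apply: le_trans hG _.
  apply: le_trans (cauchy_schwarz _ _).
  rewrite -(trmxK B) -(trmxK G) !dotv_mulmxl !trmxK dotvZl -/z -sqr_enorm expr2.
  by rewrite mulrA mulVf ?mul1r// gt_eqF.
have y0 : 0 < y by exact: lt_le_trans sy.
have mN' : (0 <= m%:R :> K) && (m%:R <= N ^+ 2) by rewrite mN ler0n.
have Db' : (0 <= D%:R :> K) && (D%:R <= b ^+ 2) by rewrite Db ler0n.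
have [x x0 tx] := tail_exponent N0 b0 t0 mN' Db' sy.
(* Both trial means have length [sqrt x], so the gain is [x * y]. *)
have := mixture_lower s_gt0 iidX (phi := phi) alpha_inj gamma_inj (B := B)
  u1 y0 ah0 ag0 (sqrtr_ge0 x) (sqrtr_ge0 x).
rewrite /A/=; apply: le_trans; rewrite lee_fin ler_expR; apply: le_trans tx _.
by rewrite -expr2 ah2 ag2 natrD !sqr_sqrtr.
Qed.

End GaussianMatrixTail.

(** * Cutting the tensor ring *)

Section Bonds.
Variables (K : realType) (q : nat -> nat).
Implicit Types G : forall k : nat, 'M[K]_(q k, q k.+1).

(* The order [k + lo], rather than [lo + k], makes the dimensions convertible. *)
Fixpoint bond_product G (lo k : nat) : 'M[K]_(q lo, q (k + lo)) :=
  if k is k'.+1 then bond_product G lo k' *m G (k' + lo)%N else 1%:M.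

Lemma chain_mulmx_add G lo k :
  chain_mulmx G (k + lo) = chain_mulmx G lo *m bond_product G lo k.
Proof. by elim: k => [|k IH] /=; rewrite ?mulmx1// mulmxA -IH. Qed.

Lemma eq_bond_product G G' lo k :
  (forall j, (lo <= j < k + lo)%N -> G j = G' j) ->
  bond_product G lo k = bond_product G' lo k.
Proof.
elim: k => //= k IH GG'; rewrite IH => [|j /andP[lj jk]]; last first.
  by apply: GG'; rewrite lj/= ltnW.
by rewrite GG'// leq_addl ltnS/=.
Qed.

Lemma eq_chain_mulmx G G' k : (forall j, (j < k)%N -> G j = G' j) ->
  chain_mulmx G k = chain_mulmx G' k.
Proof.
elim: k => //= k IH GG'; rewrite IH => [|j jk]; last by apply: GG'; rewrite ltnW.
by rewrite GG'.
Qed.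

(** The complementary arc: from the second cut to the end of the chain, then through [e] from the
    start to the first cut. *)
Definition outer_product G lo k1 k2 (e : q (k2 + (k1 + lo)) = q 0) :
    'M[K]_(q (k1 + lo), q lo) :=
  castmx (erefl, e) (bond_product G (k1 + lo) k2) *m chain_mulmx G lo.

Lemma castmx_mulmxr m n p p' (e : p = p') (A : 'M[K]_(m, n)) (B : 'M[K]_(n, p)) :
  castmx (erefl, e) (A *m B) = A *m castmx (erefl, e) B.
Proof. by case: _ / e. Qed.

(** Cyclicity of the trace. The sum over pairs of bond indices is the form from which ranks are
    bounded. *)
Lemma trace_chain_split G lo k1 k2 (e : q (k2 + (k1 + lo)) = q 0) :
  \tr (castmx (erefl, e) (chain_mulmx G (k2 + (k1 + lo)))) =
  \sum_i \sum_j bond_product G lo k1 i j * (outer_product G e)^T i j.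
Proof.
rewrite chain_mulmx_add castmx_mulmxr chain_mulmx_add -mulmxA mxtrace_mulC -mulmxA.
by apply: eq_bigr => i _; rewrite mxE; apply: eq_bigr => j _; rewrite [in RHS]mxE.
Qed.

End Bonds.

Section Matricization.
Variables (K : realType) (d : nat) (n : 'I_d -> nat).

(** The sum over [(i, j)] factors the matricization through dimension [s * t]: the left factor sees
    only [xa] and [xb], the right one only [xc] and [xe]. *)
Lemma rank_matricization_le (T : multi_index n -> K) (y : multi_index n)
    (a b c e : 'I_d) s t (f g : multi_index n -> 'M[K]_(s, t)) :
  (forall x, T x = \sum_i \sum_j f x i j * g x i j) ->
  (forall x x' : multi_index n, (forall i, i != c -> i != e -> x i = x' i) -> f x = f x') ->
  (forall x x' : multi_index n, (forall i, i != a -> i != b -> x i = x' i) -> g x = g x') ->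
  (\rank (matricization T y a b c e) <= s * t)%N.
Proof.
move=> Tfg ff gg.
pose U := \matrix_(p < n a * n b) mxvec
  (let: (xa, xb) := pair_of_index p in f (fill y xa xb (y c) (y e))).
pose V := \matrix_(p < n c * n e) mxvec
  (let: (xc, xe) := pair_of_index p in g (fill y (y a) (y b) xc xe)).
suff -> : matricization T y a b c e = U *m V^T by exact: mulmx_max_rank.
apply/matrixP => p p'; rewrite !mxE.
case Ep : (pair_of_index p) => [xa xb]; case Ep' : (pair_of_index p') => [xc xe].
rewrite Tfg (ff _ (fill y xa xb (y c) (y e))); last first.
  move=> i; rewrite eq_sym => ci; rewrite eq_sym => ei.
  by rewrite !ffunE !(dfwithout _ _ ei) !(dfwithout _ _ ci).
rewrite (gg (fill y xa xb xc xe) (fill y (y a) (y b) xc xe)); last first.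
  move=> i; rewrite eq_sym => ai; rewrite eq_sym => bi; rewrite !ffunE.
  have [<-|ei] := eqVneq e i; first by rewrite !dfwithin.
  have [ci|ci] := eqVneq c i; last by rewrite !dfwithout.
  rewrite !(dfwithout _ _ ei).
  by rewrite -ci !dfwithin.
rewrite pair_bigA [RHS](reindex _ (curry_mxvec_bij _ _))/=.
by apply: eq_bigr => -[i j] _ /=; rewrite !mxE !mxvecE Ep Ep'.
Qed.

Hypothesis d_gt0 : (0 < d)%N.
Variables (r : 'I_d -> nat) (tau : 'S_d) (u : tr_cores K n r tau).

Let pos (i : 'I_d) : nat := (tau^-1)%g i.

(** Two cuts of the ring separate the pairs. The arc [[lo, hi)] is the one that does not wrap
    around, and either pair may lie on it, whence the disjunction. *)
Definition cut_apart (a b c e : 'I_d) : Prop :=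
  exists lo hi : nat,
    let arc i := (lo <= pos i < hi)%N in
    (lo <= hi <= d)%N /\
    ([&& arc a, arc b, ~~ arc c & ~~ arc e] \/ [&& arc c, arc e, ~~ arc a & ~~ arc b]).

Lemma pos_cyc k : (k < d)%N -> pos (tau (cyc d_gt0 k)) = k.
Proof. by move=> kd; rewrite /pos permK /= modn_small. Qed.

Lemma core_at_eq (x x' : multi_index n) k : x (tau (cyc d_gt0 k)) = x' (tau (cyc d_gt0 k)) ->
  core_at d_gt0 u x k = core_at d_gt0 u x' k.
Proof. by rewrite /core_at => ->. Qed.

Lemma tr_tensor_cut lo hi : (lo <= hi <= d)%N ->
  exists f g : multi_index n -> 'M[K]_(r (cyc d_gt0 lo), r (cyc d_gt0 hi)),
  [/\ forall x, tr_tensor d_gt0 u x = \sum_i \sum_j f x i j * g x i j,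
      forall x x' : multi_index n,
        (forall i, (lo <= pos i < hi)%N -> x i = x' i) -> f x = f x' &
      forall x x' : multi_index n,
        (forall i, ~~ (lo <= pos i < hi)%N -> x i = x' i) -> g x = g x'].
Proof.
move=> /andP[lohi hid]; pose k1 := (hi - lo)%N; pose k2 := (d - hi)%N.
have hiE : hi = (k1 + lo)%N by rewrite subnK.
have dE : d = (k2 + (k1 + lo))%N by rewrite -hiE subnK.
pose q k := r (cyc d_gt0 k).
have e : q (k2 + (k1 + lo))%N = q 0%N by rewrite -dE; exact: congr1 (cyc_period d_gt0).
rewrite hiE.
exists (fun x => bond_product (core_at d_gt0 u x : forall k, 'M[K]_(q k, q k.+1)) lo k1),
  (fun x => (outer_product (core_at d_gt0 u x : forall k, 'M[K]_(q k, q k.+1)) e)^T); split.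
- move=> x; rewrite -trace_chain_split /tr_tensor.
  move: (core_at d_gt0 u x : forall k, 'M[K]_(q k, q k.+1)) => G.
  (* The length is generalized so that the equation with [d] can be eliminated; the two casts then
     agree by irrelevance of equality proofs on [nat]. *)
  move: (k2 + _)%N dE e => D DE; case: D / DE => e'.
  by rewrite (eq_irrelevance e' (congr1 r (cyc_period d_gt0))).
- move=> x x' xx'; apply: eq_bond_product => j jk; apply: core_at_eq.
  apply: xx'; rewrite pos_cyc; last by move: jk; lia.
  exact: jk.
- move=> x x' xx'; rewrite /outer_product; congr ((castmx _ _ *m _)^T).
    apply: eq_bond_product => j jk; apply: core_at_eq; apply: xx'.
    by rewrite pos_cyc; move: jk; lia.
  apply: eq_chain_mulmx => j jlo; apply: core_at_eq; apply: xx'.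
  by rewrite pos_cyc; move: jlo; lia.
Qed.

(** The rank is at most the product of the two cut bond dimensions. The theorem applies this with
    [R ^ 2] for [R], which gives a rank below [R ^ 4]. *)
Lemma rank_tr_matricization y a b c e (R : nat) :
  (forall j, (r j < R)%N) -> cut_apart a b c e ->
  (\rank (matricization (tr_tensor d_gt0 u) y a b c e) < R ^ 2)%N.
Proof.
move=> rR [lo [hi [lohi abce]]].
have [f [g [Tfg ff gg]]] := tr_tensor_cut lohi.
have lt_rr i j : (r i * r j < R ^ 2)%N by rewrite expnS expn1 ltn_mul.
case: abce => /and4P[ia ib oc oe].
  apply: leq_ltn_trans (lt_rr (cyc d_gt0 lo) (cyc d_gt0 hi)).
  apply: rank_matricization_le Tfg _ _ => x x' xx'; [apply: ff|apply: gg] => i ii; apply: xx'.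
  - by apply: contraNneq oc => <-.
  - by apply: contraNneq oe => <-.
  - by apply: contraNneq ii => ->.
  - by apply: contraNneq ii => ->.
apply: leq_ltn_trans (lt_rr (cyc d_gt0 lo) (cyc d_gt0 hi)).
apply: (@rank_matricization_le _ _ _ _ _ _ _ _ g f) => [x|x x' xx'|x x' xx'].
- by rewrite Tfg; apply: eq_bigr => i _; apply: eq_bigr => j _; rewrite mulrC.
- apply: gg => i ii; apply: xx'.
    by apply: contraNneq ii => ->.
  by apply: contraNneq ii => ->.
- apply: ff => i ii; apply: xx'.
    by apply: contraNneq oc => <-.
  by apply: contraNneq oe => <-.
Qed.

End Matricization.

(** * Cyclic orders of four positions *)

Section CorrectOrder.
Variables (d : nat) (tau : 'S_d).
Let pos (i : 'I_d) : nat := (tau^-1)%g i.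

Definition cyclically_monotone (p1 p2 p3 p4 : nat) : bool :=
  let incr a b c e := [&& a < b, b < c & c < e]%N in
  [|| incr p1 p2 p3 p4, incr p2 p3 p4 p1, incr p3 p4 p1 p2, incr p4 p1 p2 p3,
      incr p4 p3 p2 p1, incr p3 p2 p1 p4, incr p2 p1 p4 p3 | incr p1 p4 p3 p2].

Lemma correct_orderE i1 i2 i3 i4 : correct_order tau [tuple i1; i2; i3; i4] =
  uniq [:: i1; i2; i3; i4] && cyclically_monotone (pos i1) (pos i2) (pos i3) (pos i4).
Proof.
rewrite /correct_order; congr (_ && _); rewrite /cyclically_monotone.
apply/existsP/idP => [[[[|[|[|[|//]]]] ?]] /=|].
1-4: rewrite !(tnth_nth i1) /= /pos; lia.
case/or4P => [e|e|e|/or4P[e|e|e|/orP[e|e]]].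
- exists (Ordinal (isT : (0 < 4)%N)); rewrite !(tnth_nth i1) /=; move: e; rewrite /pos; lia.
- exists (Ordinal (isT : (1 < 4)%N)); rewrite !(tnth_nth i1) /=; move: e; rewrite /pos; lia.
- exists (Ordinal (isT : (2 < 4)%N)); rewrite !(tnth_nth i1) /=; move: e; rewrite /pos; lia.
- exists (Ordinal (isT : (3 < 4)%N)); rewrite !(tnth_nth i1) /=; move: e; rewrite /pos; lia.
- exists (Ordinal (isT : (0 < 4)%N)); rewrite !(tnth_nth i1) /=; move: e; rewrite /pos; lia.
- exists (Ordinal (isT : (3 < 4)%N)); rewrite !(tnth_nth i1) /=; move: e; rewrite /pos; lia.
- exists (Ordinal (isT : (2 < 4)%N)); rewrite !(tnth_nth i1) /=; move: e; rewrite /pos; lia.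
- exists (Ordinal (isT : (1 < 4)%N)); rewrite !(tnth_nth i1) /=; move: e; rewrite /pos; lia.
Qed.

Let pos_inj i j : i != j -> pos i != pos j.
Proof. by move=> ij; rewrite (inj_eq val_inj) (inj_eq perm_inj). Qed.

(** Under rotation and reflection the 24 orders of four positions form three classes of eight,
    represented by the three possible answers of the algorithm. *)
Lemma correct_order_trichotomy i1 i2 i3 i4 : uniq [:: i1; i2; i3; i4] ->
  [|| correct_order tau [tuple i1; i3; i2; i4], correct_order tau [tuple i1; i2; i3; i4]
    | correct_order tau [tuple i1; i2; i4; i3]].
Proof.
move=> u; rewrite !correct_orderE u.
have -> : uniq [:: i1; i3; i2; i4].
  rewrite -(perm_uniq (s1 := [:: i1; i2; i3; i4]))// perm_cons.
  by rewrite (perm_catCA [:: i2] [:: i3] [:: i4]).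
have -> : uniq [:: i1; i2; i4; i3].
  rewrite -(perm_uniq (s1 := [:: i1; i2; i3; i4]))// !perm_cons.
  by rewrite (perm_catC [:: i3] [:: i4]).
move: u; rewrite /= !inE !negb_or !andbT.
move=> /andP[/and3P[p12 p13 p14] /andP[/andP[p23 p24] p34]].
move: (pos_inj p12) (pos_inj p13) (pos_inj p14) (pos_inj p23) (pos_inj p24) (pos_inj p34).
rewrite /cyclically_monotone.
move: (pos i1) (pos i2) (pos i3) (pos i4) => p1 p2 p3 p4 {p12 p13 p14 p23 p24 p34}.
case: (ltngtP p1 p2) => // h12 _; case: (ltngtP p1 p3) => // h13 _;
case: (ltngtP p1 p4) => // h14 _; case: (ltngtP p2 p3) => // h23 _;
case: (ltngtP p2 p4) => // h24 _; case: (ltngtP p3 p4) => // h34 _ //=; lia.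
Qed.

Lemma cut_apartC a b c e : cut_apart tau a b c e -> cut_apart tau a b e c.
Proof.
move=> [lo [hi [lohi abce]]]; exists lo, hi; split => //.
by case: abce => /and4P[ia ib ic ie]; [left|right]; apply/and4P.
Qed.

(** Cyclically adjacent indices can be separated from the other two by two cuts; only the pairing of
    [i1] with [i3] crosses. *)
Lemma correct_order_cut i1 i2 i3 i4 : correct_order tau [tuple i1; i2; i3; i4] ->
  cut_apart tau i1 i2 i3 i4 /\ cut_apart tau i1 i4 i2 i3.
Proof.
have hull a b c e : uniq [:: a; b; c; e] ->
    (minn (pos a) (pos b) < pos c < maxn (pos a) (pos b))%N =
    (minn (pos a) (pos b) < pos e < maxn (pos a) (pos b))%N -> cut_apart tau a b c e.
  rewrite /= !inE !negb_or !andbT.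
move=> /andP[/and3P[p12 p13 p14] /andP[/andP[p23 p24] p34]].
  move: (pos_inj p12) (pos_inj p13) (pos_inj p14) (pos_inj p23) (pos_inj p24) (pos_inj p34).
  move: (ltn_ord ((tau^-1)%g a)) (ltn_ord ((tau^-1)%g b)) (ltn_ord ((tau^-1)%g c))
    (ltn_ord ((tau^-1)%g e)).
  rewrite /cut_apart -!/(pos _) => ? ? ? ? ? ? ? ? ? ?.
  (* If [c] and [e] both lie between [a] and [b], the arc is the hull of [c] and [e]; if neither
     does, it is the hull of [a] and [b]. *)
  case: (boolP (minn (pos a) (pos b) < pos c < maxn (pos a) (pos b))%N) => pc pe.
    exists (minn (pos c) (pos e)), (maxn (pos c) (pos e)).+1; split; first by lia.
    by right; lia.
  exists (minn (pos a) (pos b)), (maxn (pos a) (pos b)).+1; split; first by lia.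
  by left; lia.
rewrite correct_orderE => /andP[u cm]; split; apply: hull => //.
- by move: u cm; rewrite /= !inE !negb_or /cyclically_monotone; lia.
- rewrite -(perm_uniq (s1 := [:: i1; i2; i3; i4]))// perm_cons.
  by rewrite (perm_catC [:: i2; i3] [:: i4]).
- by move: u cm; rewrite /= !inE !negb_or /cyclically_monotone; lia.
Qed.

End CorrectOrder.

(** * The four-index algorithm under noise *)

Lemma pair_of_index_inj m n : injective (@pair_of_index m n).
Proof. by move=> p p' h; rewrite -(pair_of_indexK p) h pair_of_indexK. Qed.

Section FillEntries.
Variables (d : nat) (n : 'I_d -> nat) (y : multi_index n) (a b c e : 'I_d).
Hypothesis abce : uniq [:: a; b; c; e].

Definition fill_entry (pq : 'I_(n a * n b) * 'I_(n c * n e)) : multi_index n :=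
  fill y (pair_of_index pq.1).1 (pair_of_index pq.1).2
    (pair_of_index pq.2).1 (pair_of_index pq.2).2.

(** Distinct matrix entries read distinct tensor entries, so the noise matrix has independent
    entries. *)
Lemma fill_entry_inj : injective fill_entry.
Proof.
move: abce; rewrite /= !inE !negb_or !andbT.
move=> /andP[/and3P[ab ac ae] /andP[/andP[bc be] ce]] [p q] [p' q'].
rewrite /fill_entry/=.
case: (pair_of_index p) (@pair_of_index_inj _ _ p p') => xa xb.
case: (pair_of_index p') => xa' xb' Ip.
case: (pair_of_index q) (@pair_of_index_inj _ _ q q') => xc xe.
case: (pair_of_index q') => xc' xe' Iq /= h.
have he : xe = xe'.
  by have := congr1 (fun f : multi_index n => f e) h; rewrite !ffunE !dfwithin.
have hc : xc = xc'.
  have := congr1 (fun f : multi_index n => f c) h.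
  by rewrite !ffunE !(@dfwithout _ _ _ e) 1?eq_sym// !dfwithin.
have hb : xb = xb'.
  have := congr1 (fun f : multi_index n => f b) h.
  by rewrite !ffunE !(@dfwithout _ _ _ e) 1?eq_sym// !(@dfwithout _ _ _ c) 1?eq_sym// !dfwithin.
have ha : xa = xa'.
  have := congr1 (fun f : multi_index n => f a) h.
  rewrite !ffunE !(@dfwithout _ _ _ e) 1?eq_sym// !(@dfwithout _ _ _ c) 1?eq_sym//.
  by rewrite !(@dfwithout _ _ _ b) 1?eq_sym// !dfwithin.
by rewrite Ip ?ha ?hb// Iq ?hc ?he.
Qed.

Lemma matricizationE (K : realType) (T : multi_index n -> K) :
  matricization T y a b c e = \matrix_(p, q) T (fill_entry (p, q)).
Proof.
apply/matrixP => p q; rewrite !mxE /fill_entry/=.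
by case: (pair_of_index p) (pair_of_index q) => [xa xb] [xc xe].
Qed.

Lemma matricizationD (K : realType) (T E : multi_index n -> K) :
  matricization (fun x => T x + E x) y a b c e =
  matricization T y a b c e + matricization E y a b c e.
Proof. by rewrite !matricizationE; apply/matrixP => p q; rewrite !mxE. Qed.

End FillEntries.

Section NoisyMatricization.
Local Open Scope classical_set_scope.
Variables (K : realType) (d : nat) (n : 'I_d -> nat) (y : multi_index n).
Hypothesis n_gt0 : forall i, (0 < n i)%N.
Context disp (Omega : measurableType disp) (P : probability Omega K).
Variables (s : K) (noise : multi_index n -> {RV P >-> K}).
Hypotheses (s_gt0 : 0 < s) (iid_noise : normal_iid s noise).
Let noise_mx a b c e w := matricization (noise ^~ w) y a b c e.
Variable N : nat.
Hypotheses (N_ge4 : (4 <= N)%N) (n_le : forall i, (n i <= N)%N).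

Lemma noise_matricization_tail a b c e D (B : 'M[K]_(n c * n e, D)) (be t : K) :
  uniq [:: a; b; c; e] -> (D <= n c * n e)%N -> B^T *m B = 1%:M ->
  0 < be -> D%:R <= be ^+ 2 -> 0 <= t ->
  exists A : set Omega, [/\ measurable A, (P A <= (expR (- (t ^+ 2 / 2)))%:E)%E &
    forall w v, v != 0 ->
      s * (8 / 5 * N%:R + 3 / 4 * (be ^+ 2 / N%:R) + t) * enorm v <=
      enorm (noise_mx a b c e w *m (B *m v)) -> A w].
Proof.
move=> abce Dn BB be0 Dbe t0.
pose phi := fill_entry y (a := a) (b := b) (c := c) (e := e).
have phi_inj : injective phi by exact: fill_entry_inj.
have ab0 : (0 < n a * n b)%N by rewrite muln_gt0 !n_gt0.
have ce0 : (0 < n c * n e)%N by rewrite muln_gt0 !n_gt0.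
(* The mixing variables are taken from the first column and the first row of the noise matrix.
   Overlap with the matrix is harmless, since they are evaluated on independent copies of
   [Omega]. *)
pose alpha p := phi (p, Ordinal ce0).
pose gamma j := phi (Ordinal ab0, widen_ord Dn j).
have alpha_inj : injective alpha by move=> p p' /phi_inj[].
have gamma_inj : injective gamma by move=> j j' /phi_inj[] /val_inj.
have N0 : 0 < N%:R :> K by rewrite ltr0n; lia.
have mN : (n a * n b)%:R <= N%:R ^+ 2 :> K by rewrite -natrX ler_nat expnS expn1 leq_mul.
have [A [mA PA hA]] := gaussian_matrix_tail s_gt0 iid_noise phi_inj alpha_inj gamma_inj
  BB N0 be0 t0 mN Dbe.
by exists A; split => // w v v0 h; apply: (hA w v v0);
  move: h; rewrite /noise_mx matricizationE.
Qed.

Let square_budget (k p : nat) : (k <= N ^ 2)%N -> (p <= N ^ 2)%N ->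
  ((p - k).+1%:R <= N%:R ^+ 2 - k%:R + 1 :> K) /\ 0 < N%:R ^+ 2 - k%:R + 1 :> K.
Proof.
move=> kN pN; rewrite -natrX -natrB// natr1 ltr0Sn ler_nat; split => //; lia.
Qed.

Lemma noisy_singular_value_large (T : multi_index n -> K) (sigma t : K) (R : nat) a b c e :
  uniq [:: a; b; c; e] -> (0 < R)%N -> (forall i, (R ^ 2 <= n i)%N) -> 0 <= t ->
  sigma <= singular_value (R ^ 4) (matricization T y a b c e) ->
  exists A : set Omega, [/\ measurable A, (P A <= (expR (- (t ^+ 2 / 2)))%:E)%E &
    forall w, ~ A w -> sigma - s * (8 / 5 * N%:R + 3 / 4 * ((R ^ 4)%:R / N%:R) + t) <
      singular_value (R ^ 4) (matricization (fun x => T x + noise x w) y a b c e)].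
Proof.
move=> abce R0 Rn t0 sigmaT.
have kn : (0 < R ^ 4 <= n c * n e)%N.
  by rewrite expn_gt0 R0/= (expnM _ 2 2) expnS expn1 leq_mul.
have [V [VV hV]] := singular_value_perturb_big (matricization T y a b c e) kn.
have be0 : 0 < (R ^ 2)%:R :> K by rewrite ltr0n expn_gt0 R0.
have beE : (R ^ 2)%:R ^+ 2 = (R ^ 4)%:R :> K by rewrite -natrX -expnM.
have [|||A [mA PA hA]] := noise_matricization_tail (t := t) abce _ VV be0 => //.
- by case/andP: kn.
- by rewrite beE.
exists A; split => // w Aw; rewrite ltNge; apply/negP => h; apply: Aw.
have [v [v0 hv]] := hV (noise_mx a b c e w).
apply: (hA w v v0); apply: le_trans hv; rewrite ler_pM2r ?enorm_gt0//.
by rewrite beE -matricizationD lerBrDl; move: h sigmaT; set x := s * _; lra.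
Qed.

Lemma noisy_singular_value_small (T : multi_index n -> K) (t : K) (R : nat) a b c e :
  uniq [:: a; b; c; e] -> (forall i, (R ^ 2 <= n i)%N) -> 0 <= t ->
  (\rank (matricization T y a b c e) < R ^ 4)%N ->
  exists A : set Omega, [/\ measurable A, (P A <= (expR (- (t ^+ 2 / 2)))%:E)%E &
    forall w, ~ A w ->
      singular_value (R ^ 4) (matricization (fun x => T x + noise x w) y a b c e) <
      s * (8 / 5 * N%:R + 3 / 4 * ((N%:R ^+ 2 - (R ^ 4)%:R + 1) / N%:R) + t)].
Proof.
move=> abce Rn t0 rT.
have kn : (R ^ 4 <= n c * n e)%N by rewrite (expnM _ 2 2) expnS expn1 leq_mul.
have pN : (n c * n e <= N ^ 2)%N by rewrite expnS expn1 leq_mul.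
have [dB b20] := square_budget (leq_trans kn pN) pN.
have [U [UU hU]] := singular_value_perturb_small rT kn.
(* The squared width bounds the dimension [n c * n e - R ^ 4 + 1] of [U]; together with the width
   [R ^ 2] of the large case, the squares add up to [N ^ 2 + 1]. *)
pose be := Num.sqrt (N%:R ^+ 2 - (R ^ 4)%:R + 1 : K).
have be0 : 0 < be by rewrite sqrtr_gt0.
have beE : be ^+ 2 = N%:R ^+ 2 - (R ^ 4)%:R + 1 by rewrite sqr_sqrtr// ltW.
have [|||A [mA PA hA]] := noise_matricization_tail (t := t) abce _ UU be0 => //.
(* [U] fits in the column space since [R ^ 4 > 0], a consequence of the strict rank bound. *)
- by have := leq_ltn_trans (leq0n _) rT; lia.
- by rewrite beE.
exists A; split => // w Aw; rewrite ltNge; apply/negP => h; apply: Aw.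
have [v [v0 hv]] := hU (noise_mx a b c e w).
apply: (hA w v v0); apply: le_trans hv; rewrite ler_pM2r ?enorm_gt0//.
by rewrite beE -matricizationD.
Qed.

End NoisyMatricization.

Lemma incorrect_output_four_index (K : realType) (d : nat) (tau : 'S_d)
    (n : 'I_d -> nat) (R : nat) (T : multi_index n -> K) (y : multi_index n)
    (i1 i2 i3 i4 : 'I_d) :
  let a := singular_value (R ^ 4) (matricization T y i1 i2 i3 i4) in
  let b := singular_value (R ^ 4) (matricization T y i1 i3 i2 i4) in
  let c := singular_value (R ^ 4) (matricization T y i1 i4 i2 i3) in
  incorrect_output tau (four_index R T y i1 i2 i3 i4) =
  if (b < a) && (c < a) then ~~ correct_order tau [tuple i1; i3; i2; i4]
  else if (a < b) && (c < b) then ~~ correct_order tau [tuple i1; i2; i3; i4]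
  else if (a < c) && (b < c) then ~~ correct_order tau [tuple i1; i2; i4; i3]
  else true.
Proof.
move=> a b c; rewrite /four_index !gt_max -/a -/b -/c.
by case: ifP => //; case: ifP => //; case: ifP.
Qed.

Section MeasurableOutput.
Local Open Scope classical_set_scope.

Lemma measurable_incorrect_output (K : realType) (d : nat) (tau : 'S_d)
    (n : 'I_d -> nat) (R : nat) disp (Omega : measurableType disp)
    (T : Omega -> multi_index n -> K) (y : multi_index n) (i1 i2 i3 i4 : 'I_d) :
  (0 < R)%N -> (forall i, (R ^ 2 <= n i)%N) ->
  (forall x, measurable_fun setT (T ^~ x)) ->
  measurable [set w | incorrect_output tau (four_index R (T w) y i1 i2 i3 i4)].
Proof.
move=> R0 Rn mT.
have mM a b c e : measurable_fun setT
    (fun w => singular_value (R ^ 4) (matricization (T w) y a b c e)).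
  apply: measurable_singular_value => [|p q].
    by rewrite expn_gt0 R0/= (expnM _ 2 2) expnS expn1 leq_mul.
  under eq_fun do rewrite matricizationE mxE.
  exact: mT.
have mlt a b c e a' b' c' e' := measurable_fun_ltr (mM a b c e) (mM a' b' c' e').
rewrite [X in measurable X](_ : _ = (fun w =>
    incorrect_output tau (four_index R (T w) y i1 i2 i3 i4)) @^-1` [set true])//.
rewrite -[X in measurable X]setTI.
suff : measurable_fun setT (fun w : Omega =>
    incorrect_output tau (four_index R (T w) y i1 i2 i3 i4)) by apply.
under eq_fun do rewrite incorrect_output_four_index.
apply: measurable_fun_ifT => //; first exact: measurable_and.
apply: measurable_fun_ifT => //; first exact: measurable_and.
apply: measurable_fun_ifT => //; exact: measurable_and.
Qed.
End MeasurableOutput.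

Theorem theorem4p11 (K : realType) (d : nat) (d_gt0 : (0 < d)%N)
    (n r : 'I_d -> nat)
    (n_gt0 : forall i, (0 < n i)%N) (r_gt0 : forall j, (0 < r j)%N)
    (tau : 'S_d) (R : nat) (R_gt0 : (0 < R)%N)
    (le_R2_n : forall i, (R ^ 2 <= n i)%N)
    (lt_r_R2 : forall j, (r j < R ^ 2)%N)
    (le_R_r : forall j, (R <= r j)%N)
    (u : tr_cores K n r tau)
    (sigma : K) (sigma_gt0 : 0 < sigma)
    (sigma_bound : forall (i1 i2 i3 i4 : 'I_d) (y : multi_index n),
       correct_order tau [tuple i1; i2; i3; i4] ->
       sigma <= singular_value (R ^ 4)
                  (matricization (tr_tensor d_gt0 u) y i1 i3 i2 i4))
    (disp : measure_display) (Omega : measurableType disp)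
    (P : probability Omega K)
    (sigma_e : K) (sigma_e_gt0 : 0 < sigma_e)
    (noise : multi_index n -> {RV P >-> K})
    (noise_normal : forall (x : multi_index n) (A : set K), measurable A ->
       distribution P (noise x) A = normal_prob 0 sigma_e A)
    (noise_indep : mutually_independent noise)
    (T : K) (lt_T : T < sigma / sigma_e)
    (i1 i2 i3 i4 : 'I_d) (i_uniq : uniq [:: i1; i2; i3; i4])
    (y : multi_index n) :
  let n_max := (\max_(i < d) n i)%N in
  let observed (w : Omega) (x : multi_index n) :=
    tr_tensor d_gt0 u x + noise x w in
  (P [set w | incorrect_output tau
                (four_index R (observed w) y i1 i2 i3 i4)]%classic
   <= (6 * expR (- (1 / 8 * Num.max (T - 4 * n_max%:R) 0 ^+ 2)))%:E)%E.
Proof.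
cbv zeta; set N := (\max_(i < d) n i)%N.
pose observed w (x : multi_index n) := tr_tensor d_gt0 u x + noise x w.
pose bad := [set w | incorrect_output tau (four_index R (observed w) y i1 i2 i3 i4)]%classic.
rewrite -/bad.
have mbad : measurable bad.
  apply: measurable_incorrect_output => // x.
  by apply: measurable_funD => //; exact: measurable_funP.
have nN i : (n i <= N)%N by exact: leq_bigmax.
(* [R <= r j < R ^ 2] excludes [R = 1]. *)
have R2 : (2 <= R)%N.
  have := leq_ltn_trans (le_R_r (Ordinal d_gt0)) (lt_r_R2 (Ordinal d_gt0)).
  by case: (R) R_gt0 => [|[|]].
have N4 : (4 <= N)%N.
  apply: leq_trans (nN (Ordinal d_gt0)); apply: leq_trans (le_R2_n _).
  by rewrite (@leq_exp2r 2 R 2).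
(* Here the claimed bound is 6, which exceeds any probability. *)
have [T4|T4] := leP T (4 * N%:R).
  rewrite max_r ?subr_le0// expr0n mulr0 oppr0 expR0 mulr1.
  by apply: le_trans (probability_le1 P mbad) _; rewrite lee_fin ler1n.
rewrite max_l ?subr_ge0 ?(ltW T4)//.
(* Half of the excess, since the large and the small singular value may each deviate by [t]. *)
pose t := (T - 4 * N%:R) / 2; have t0 : 0 <= t by rewrite divr_ge0// subr_ge0 ltW.
have -> : 1 / 8 * (T - 4 * N%:R) ^+ 2 = t ^+ 2 / 2 by rewrite /t; field.
have TE : T = 4 * N%:R + 2 * t by rewrite /t; field.
have iid : normal_iid sigma_e noise by [].
have u1324 : uniq [:: i1; i3; i2; i4].
  rewrite -(perm_uniq (s1 := [:: i1; i2; i3; i4]))// perm_cons.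
  by rewrite (perm_catCA [:: i2] [:: i3] [:: i4]).
have u1423 : uniq [:: i1; i4; i2; i3].
  rewrite -(perm_uniq (s1 := [:: i1; i2; i3; i4]))// perm_cons.
  by rewrite (perm_catC [:: i2; i3] [:: i4]).
pose sv a b c e w := singular_value (R ^ 4) (matricization (observed w) y a b c e).
(* The powers of [R] cancel, and the thresholds sum to [79 / 20 * N + 3 / 4 / N + 2 * t], at most
   [4 * N + 2 * t] because [N >= 4]. *)
have budget : sigma_e * (8 / 5 * N%:R + 3 / 4 * ((N%:R ^+ 2 - (R ^ 4)%:R + 1) / N%:R) + t) <=
    sigma - sigma_e * (8 / 5 * N%:R + 3 / 4 * ((R ^ 4)%:R / N%:R) + t).
  rewrite lerBrDr -mulrDr; apply: (@le_trans _ _ (sigma_e * T)); last first.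
    by rewrite mulrC -ler_pdivlMr// ltW.
  rewrite ler_pM2l// TE.
  have N0 : 4 <= N%:R :> K by rewrite ler_nat.
  have -> : (N%:R ^+ 2 - (R ^ 4)%:R + 1) / N%:R = N%:R - (R ^ 4)%:R / N%:R + N%:R^-1 :> K.
    by field; rewrite gt_eqF// (lt_le_trans _ N0).
  have : N%:R^-1 <= 4^-1 :> K by rewrite lef_pV2 ?posrE// (lt_le_trans _ N0).
  by lra.
have rank_small a b c e : cut_apart tau a b c e ->
    (\rank (matricization (tr_tensor d_gt0 u) y a b c e) < R ^ 4)%N.
  by move=> /(rank_tr_matricization d_gt0 u y lt_r_R2); rewrite -expnM.
(* Index 0 is the crossing pairing, 1 and 2 are the cut ones. Outside three exceptional events the
   crossing one wins. *)
have win a0 b0 c0 e0 a1 b1 c1 e1 a2 b2 c2 e2 :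
    uniq [:: a0; b0; c0; e0] -> uniq [:: a1; b1; c1; e1] -> uniq [:: a2; b2; c2; e2] ->
    sigma <= singular_value (R ^ 4) (matricization (tr_tensor d_gt0 u) y a0 b0 c0 e0) ->
    cut_apart tau a1 b1 c1 e1 -> cut_apart tau a2 b2 c2 e2 ->
    (forall w, sv a1 b1 c1 e1 w < sv a0 b0 c0 e0 w -> sv a2 b2 c2 e2 w < sv a0 b0 c0 e0 w ->
      ~ bad w) ->
    (P bad <= (6 * expR (- (t ^+ 2 / 2)))%:E)%E.
  move=> u0 u1 u2 big cut1 cut2 nbad.
  have [A0 [mA0 PA0 hA0]] :=
    noisy_singular_value_large n_gt0 sigma_e_gt0 iid N4 nN u0 R_gt0 le_R2_n t0 big.
  have [A1 [mA1 PA1 hA1]] :=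
    noisy_singular_value_small n_gt0 sigma_e_gt0 iid N4 nN u1 le_R2_n t0
      (rank_small _ _ _ _ cut1).
  have [A2 [mA2 PA2 hA2]] :=
    noisy_singular_value_small n_gt0 sigma_e_gt0 iid N4 nN u2 le_R2_n t0
      (rank_small _ _ _ _ cut2).
  apply: (@le_trans _ _ (P (A0 `|` (A1 `|` A2))%classic)).
    apply: le_measure; rewrite ?inE//; first by do 2 apply: measurableU => //.
    move=> w badw; apply: contrapT => nA; apply: (nbad w) badw.
      apply: lt_le_trans (hA1 w _) _; first by move=> A1w; apply: nA; right; left.
      by apply: le_trans budget _; apply/ltW/hA0 => A0w; apply: nA; left.
    apply: lt_le_trans (hA2 w _) _; first by move=> A2w; apply: nA; right; right.
    by apply: le_trans budget _; apply/ltW/hA0 => A0w; apply: nA; left.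
  apply: (@le_trans _ _ (P A0 + (P A1 + P A2))%E).
    apply: le_trans (measureU2 P mA0 (measurableU _ _ mA1 mA2)) _.
    by rewrite leeD2l// measureU2.
  apply: le_trans (leeD PA0 (leeD PA1 PA2)) _.
  (* The union bound gives the factor 3, within the claimed 6. *)
  rewrite -!EFinD lee_fin; have := expR_ge0 (- (t ^+ 2 / 2)); lra.
have badE w : bad w = incorrect_output tau (four_index R (observed w) y i1 i2 i3 i4) by [].
case/or3P: (correct_order_trichotomy tau i_uniq) => ok;
  have [cut1 cut2] := correct_order_cut ok.
- apply: win (sigma_bound _ _ _ _ y ok) cut1 (cut_apartC cut2) _ => //.
  by move=> w; rewrite badE incorrect_output_four_index /sv => -> ->; rewrite ok.
- apply: win (sigma_bound _ _ _ _ y ok) cut1 cut2 _ => //.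
  move=> w; rewrite badE incorrect_output_four_index /sv => h1 h2.
  by rewrite (lt_gtF h1) h1 h2 ok.
- apply: win (sigma_bound _ _ _ _ y ok) (cut_apartC cut1) cut2 _ => //.
  move=> w; rewrite badE incorrect_output_four_index /sv => h1 h2.
  by rewrite (lt_gtF h1) (lt_gtF h2) !andbF h1 h2 ok.
Qed.
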